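(* Let $F$ be a translation fractal in $\mathbb R$ with spectral triple $(\mathcal A,\mathcal H,D)$, and let $h$ be a gauge function for which the Hausdorff–Besicovitch measure $\mathcal H^h$ is non-trivial on $F$, i.e. $0<\mathcal H^h(F)<\infty$ (as provided by Kahane–Salem). Then all the Hausdorff–Besicovitch functionals on $\mathcal A$ give rise to the same measure on $F$, which is, up to normalization, the restriction of $\mathcal H^h$ to $F$: for every singular traceability exponent $s$ of $|D|^{-1}$ and every singular trace $\tau_\omega$ with $\tau_\omega(|D|^{-s})=1$, $$\tau_\omega(f|D|^{-s})=\frac1{\mathcal H^h(F)}\int_Ff\,d\mathcal H^h\qquad\text{for all } f\in\mathcal A.$$
   Context: Limit fractal: let $a<b$ and, for each $n\ge1$, let $w_{n1},\dots,w_{np_n}$ be contracting similarities of $\mathbb R$ with dilation parameters $\lambda_{ni}\in(0,1)$ such that (1) $w_{ni}([a,b])\subset[a,b]$; (2) $w_{ni}([a,b])\cap w_{nj}([a,b])=\emptyset$ for $i\ne j$; (3) $\bigcup_iw_{ni}(\{a,b\})\supset\{a,b\}$. Put $w_n(\Omega)=\bigcup_{i=1}^{p_n}w_{ni}(\Omega)$ and $F=\bigcap_n w_1\circ\cdots\circ w_n([a,b])$; $F$ is a fractal in $\mathbb R$, i.e. compact, totally disconnected and without isolated points. $F$ is a translation fractal if the parameters $\lambda_{ni}=\lambda_n$ do not depend on $i$. For a multi-index $\sigma$ of length $n$, $w_\sigma=w_{1\sigma(1)}\circ\cdots\circ w_{n\sigma(n)}$. Spectral triple: for a bounded interval $I$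 let $\mathcal H(I)=\ell^2(\partial I)$, $D(I)=\frac1{|I|}\begin{pmatrix}0&1\\1&0\end{pmatrix}$. Let $I_1,I_2,\dots$ be the lacunae of $F$ (connected components of $[a,b]\setminus F$), $\mathcal H_\ell=\bigoplus_k\mathcal H(I_k)$, $D_\ell=\bigoplus_kD(I_k)$; let $\mathcal F_n=\{w_\sigma([a,b]):|\sigma|=n\}$ (with $\mathcal F_0=\{[a,b]\}$), $\mathcal H_f=\bigoplus_{n,\,I\in\mathcal F_n}\mathcal H(I)$, $D_f=\bigoplus_{n,\,I\in\mathcal F_n}D(I)$. Then $\mathcal H=\mathcal H_\ell\oplus\mathcal H_f$, $D=D_\ell\oplus D_f$, and $\mathcal A=\mathrm{Lip}(F)$ acts by pointwise multiplication. A gauge function is a non-decreasing right-continuous $h:[0,\infty)\to[0,\infty)$ with $h(0)=0$; $\mathcal H^h(E)=\lim_{\delta\to0}\inf\{\sum_{i}h(\mathrm{diam}A_i):\bigcup_iA_i\supset E,\ \mathrm{diam}A_i\le\delta\}$. A singular trace on $\mathcal B(\mathcal H)$ is a positive tracial weight $\tau:\mathcal B(\mathcal H)_+\to[0,\infty]$ vanishing on finite rank projections, extended linearly to its domain. $s>0$ is a singular traceability exponent for $|D|^{-1}$ if some singular trace is finite and nonzero on $|D|^{-s}$; the Hausdorff–Besicovitch functionals on $\mathcal A$ are $f\mapsto\tau_\omega(f|D|^{-s})$ for such $s$, $\tau_\omega$. *)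

(* Defs.v *)
From HB Require Import structures.
From mathcomp Require Import all_boot all_order all_algebra.
From mathcomp Require Import complex ring.
From mathcomp Require Import all_classical all_reals all_analysis.

Set Implicit Arguments.
Unset Strict Implicit.
Unset Printing Implicit Defensive.

Import Order.TTheory GRing.Theory Num.Theory.
Import numFieldNormedType.Exports.
Import ComplexField.Normc.

Local Open Scope classical_set_scope.
Local Open Scope complex_scope.
Local Open Scope ring_scope.

Local Notation Re := complex.Re.
Local Notation Im := complex.Im.

Section Hausdorff.
Context {R : realType}.
Implicit Types (h : R -> R) (A : set R).

(* Only the values of [h] on [0, +oo[ are constrained (and used). *)
Definition gauge h : Prop :=
  [/\ h 0 = 0,
      (forall x, 0 <= x -> 0 <= h x),
      (forall x y, 0 <= x -> x <= y -> h x <= h y) &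
      (forall x, 0 <= x -> h y @[y --> x^'+] --> h x)].

(* The point 0 is added so that the diameter of the empty set is 0. *)
Definition diam A : \bar R :=
  ereal_sup (0%E |` [set `|x - y|%:E | x in A & y in A]).

Definition hausdorff_pre h (d : R) A : \bar R :=
  ereal_inf [set (\sum_(0 <= i <oo) (h (fine (diam (U i))))%:E)%E
            | U in [set U : nat -> set R |
                A `<=` \bigcup_i U i /\ forall i, (diam (U i) <= d%:E)%E]].

(* This is an outer measure on all subsets of the line; it is a metric outer
   measure, so that its restriction to the Borel sets is a measure. *)
Definition hausdorff h A : \bar R := lim (hausdorff_pre h d A @[d --> 0^'+]).

(* The library integral against [mu] uses the values of [mu] on the Borel sets
   only. *)
Definition cintegral (mu : set R -> \bar R) (D : set R) (f : R -> R[i]) : R[i] :=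
  fine (\int[mu]_(x in D) (Re (f x))%:E) +i*
  fine (\int[mu]_(x in D) (Im (f x))%:E).

End Hausdorff.

Section SquareSummable.
Context {R : realType} (I : choiceType).
Local Notation C := (R[i])^o.

Definition sqsum (xi : I -> C) : \bar R :=
  (\esum_(i in [set: I]) (normc (xi i) ^+ 2)%:E)%E.

Definition sqsummable : {pred I -> C} := [pred xi | (sqsum xi < +oo)%E].

Lemma normc2E (z : R[i]) : normc z ^+ 2 = Re z ^+ 2 + Im z ^+ 2.
Proof. by case: z => x y /=; rewrite sqr_sqrtr// addr_ge0// sqr_ge0. Qed.

Lemma normcZD_le (c x y : R[i]) :
  normc (c * x + y) ^+ 2 <= 2 * normc c ^+ 2 * normc x ^+ 2 + 2 * normc y ^+ 2.
Proof.
rewrite !normc2E; case: c x y => c d [x y] [u v] /=; rewrite -subr_ge0.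
suff -> : 2 * (c ^+ 2 + d ^+ 2) * (x ^+ 2 + y ^+ 2) + 2 * (u ^+ 2 + v ^+ 2) -
    ((c * x - d * y + u) ^+ 2 + (c * y + d * x + v) ^+ 2) =
    (c * x - d * y - u) ^+ 2 + (c * y + d * x - v) ^+ 2.
  by rewrite addr_ge0// sqr_ge0.
by ring.
Qed.

Fact sqsummable_submod : submod_closed sqsummable.
Proof.
split=> [|c xi eta]; rewrite !inE.
- rewrite /sqsum esum1 ?ltry// => i _.
  by rewrite normc2E /= expr0n /= addr0.
rewrite /sqsum => fxi feta.
pose m := normc c ^+ 2.
apply: (@le_lt_trans _ _ (\esum_(i in [set: I])
  ((2 * m * normc (xi i) ^+ 2)%:E + (2 * normc (eta i) ^+ 2)%:E))%E).
  by apply: le_esum => i _; rewrite -EFinD lee_fin; exact: normcZD_le.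
have n0 (z : R[i]) : 0 <= normc z ^+ 2 by apply: sqr_ge0.
have m0 : 0 <= 2 * m by apply: mulr_ge0 => //; exact: n0.
rewrite esumD; last 2 first.
- by move=> i _; rewrite lee_fin; apply: mulr_ge0 => //; exact: n0.
- by move=> i _; rewrite lee_fin; apply: mulr_ge0 => //; exact: n0.
have esumZ (k : R) (g : I -> C) : 0 <= k -> (sqsum g < +oo)%E ->
    (\esum_(i in [set: I]) (k * normc (g i) ^+ 2)%:E < +oo)%E.
  move=> k0 fg; apply: (@le_lt_trans _ _ (k%:E * sqsum g)%E); last first.
    by apply: lte_mul_pinfty => //; rewrite ?lee_fin.
  apply: ge_ereal_sup => _ [X [finX _]] <-.
  rewrite (eq_fsbigr (fun i => (k%:E * (normc (g i) ^+ 2)%:E)%E)); last first.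
    by move=> i _; rewrite EFinM.
  rewrite -ge0_mule_fsumr; last by move=> i; rewrite lee_fin; exact: n0.
  apply: lee_wpmul2l; rewrite ?lee_fin//.
  by apply: esum_ge; exists X.
by apply: lte_add_pinfty; apply: esumZ.
Qed.

HB.instance Definition _ :=
  GRing.isSubmodClosed.Build R[i] (I -> C) sqsummable sqsummable_submod.

Record ell2 := Ell2 { ell2_val :> I -> C ; _ : ell2_val \in sqsummable }.
HB.instance Definition _ := [isSub for ell2_val].
HB.instance Definition _ := [Choice of ell2 by <:].
HB.instance Definition _ := [SubChoice_isSubLmodule of ell2 by <:].

End SquareSummable.

Arguments ell2 : clear implicits.

Section HilbertSpace.
Context {R : realType} {I : choiceType}.
Local Notation H := (ell2 R I).

(* Unconditional sum of an absolutely summable complex family. *)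
Definition rsum (g : I -> R) : R :=
  fine (\esum_(i in [set: I]) (Num.max (g i) 0)%:E)%E -
  fine (\esum_(i in [set: I]) (Num.max (- g i) 0)%:E)%E.

Definition csum (g : I -> R[i]) : R[i] :=
  rsum (fun i => Re (g i)) +i* rsum (fun i => Im (g i)).

Definition inner (xi eta : H) : R[i] := csum (fun i => conjc (xi i) * eta i).

Definition l2norm (xi : H) : R := Num.sqrt (fine (sqsum xi)).

Definition bounded_operator (A : H -> H) : Prop :=
  linear A /\ exists M : R, forall xi, l2norm (A xi) <= M * l2norm xi.

Definition adjoint_pair (A B : H -> H) : Prop :=
  forall xi eta, inner (A xi) eta = inner xi (B eta).

(* In the order of [R[i]], [0 <= z] means that [z] is real and nonnegative. *)
Definition positive_operator (A : H -> H) : Prop :=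
  bounded_operator A /\ forall xi, 0 <= inner xi (A xi).

Definition finite_rank_projection (P : H -> H) : Prop :=
  [/\ bounded_operator P, P \o P = P, adjoint_pair P P &
      exists (n : nat) (e : 'I_n -> H), forall xi,
        exists c : 'I_n -> R[i], P xi = \sum_(k < n) c k *: e k].

(* [tau] is only constrained on the bounded positive operators; its values
   elsewhere are never used. *)
Definition singular_trace (tau : (H -> H) -> \bar R) : Prop :=
  [/\ forall A, positive_operator A -> (0 <= tau A)%E,
      forall A B, positive_operator A -> positive_operator B ->
        tau (A + B) = (tau A + tau B)%E,
      forall (c : R) A, 0 <= c -> positive_operator A ->
        tau (c%:C *: A) = (c%:E * tau A)%E,
      forall A B, bounded_operator A -> bounded_operator B ->
        adjoint_pair A B -> tau (B \o A) = tau (A \o B) &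
      forall P, finite_rank_projection P -> tau P = 0%E].

Definition trace_finite (tau : (H -> H) -> \bar R) (A : H -> H) : Prop :=
  positive_operator A /\ (tau A < +oo)%E.

(* [T] is a linear combination of positive operators of finite trace, and [z]
   is the corresponding combination of traces. *)
Definition trace_value (tau : (H -> H) -> \bar R) (T : H -> H) (z : R[i]) :=
  exists A1 A2 B1 B2 : H -> H,
    [/\ trace_finite tau A1, trace_finite tau A2, trace_finite tau B1 &
        trace_finite tau B2] /\
    T = (A1 - A2) + 'i%C *: (B1 - B2) /\
    z = (fine (tau A1) - fine (tau A2)) +i* (fine (tau B1) - fine (tau B2)).

Definition trace_domain (tau : (H -> H) -> \bar R) : set (H -> H) :=
  [set T | exists z, trace_value tau T z].

Definition trace_ext (tau : (H -> H) -> \bar R) (T : H -> H) : R[i] :=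
  xget 0 (trace_value tau T).

(* An unbounded operator is given by its graph. *)
Definition eigenvector (D : H -> H -> Prop) (mu : R) (xi : H) : Prop :=
  D xi (mu%:C *: xi).

(* For a selfadjoint [D] whose eigenvectors span a dense subspace, this
   characterizes the bounded operator phi(D). *)
Definition is_function_of (D : H -> H -> Prop) (phi : R -> R) (T : H -> H) :=
  bounded_operator T /\
  forall mu xi, eigenvector D mu xi -> T xi = (phi mu)%:C *: xi.

Definition function_of (D : H -> H -> Prop) (phi : R -> R) : H -> H :=
  xget 0 (is_function_of D phi).

Definition abs_power (D : H -> H -> Prop) (r : R) : H -> H :=
  function_of D (fun mu => `|mu| `^ r).

(* [insubd 0] maps a family which is not square-summable to 0; this does not
   occur when [g] is bounded. *)
Definition multiplication (g : I -> R[i]) (xi : H) : H :=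
  insubd (0 : H) (fun i => g i * xi i).

End HilbertSpace.

Record limit_system (R : realType) := LimitSystem {
  lend : R;
  rend : R;
  nmaps : nat -> nat;
  ratio : nat -> nat -> R;
  (* The maps w_{n1}, ..., w_{n p_n} (n >= 1) are
     [smap (n - 1) 0, ..., smap (n - 1) (p_n - 1)]. *)
  smap : nat -> nat -> R -> R;
  lend_lt_rend : lend < rend;
  ratio_itv : forall n i, (i < nmaps n)%N -> 0 < ratio n i < 1;
  smap_similarity : forall n i, (i < nmaps n)%N ->
    forall x y, `|smap n i x - smap n i y| = ratio n i * `|x - y|;
  smap_stable : forall n i, (i < nmaps n)%N ->
    smap n i @` `[lend, rend] `<=` `[lend, rend];
  smap_disjoint : forall n i j, (i < nmaps n)%N -> (j < nmaps n)%N ->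
    i <> j -> (smap n i @` `[lend, rend]) `&` (smap n j @` `[lend, rend]) = set0;
  smap_ends : forall n, [set lend; rend] `<=`
    \bigcup_(i in `I_(nmaps n)) (smap n i @` [set lend; rend]) }.

Definition translation_system (R : realType) (S : limit_system R) : Prop :=
  forall n i j, (i < nmaps S n)%N -> (j < nmaps S n)%N ->
    ratio S n i = ratio S n j.

Section Fractal.
Context {R : realType} (S : limit_system R).

Definition smap_set (n : nat) (A : set R) : set R :=
  \bigcup_(i in `I_(nmaps S n)) (smap S n i @` A).

(* w_1 o ... o w_n *)
Fixpoint iter_set (n : nat) (A : set R) : set R :=
  if n is m.+1 then iter_set m (smap_set m A) else A.

Definition fractal : set R :=
  \bigcap_n iter_set n.+1 `[lend S, rend S].

(* w_sigma for the multi-index (sigma 0, ..., sigma (n - 1)). *)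
Fixpoint word_map (sigma : nat -> nat) (n : nat) : R -> R :=
  if n is m.+1 then word_map sigma m \o smap S m (sigma m) else id.

Definition tiles (n : nat) : set (set R) :=
  [set word_map sigma n @` `[lend S, rend S] |
    sigma in [set sigma | forall k, (k < n)%N -> (sigma k < nmaps S k)%N]].

Definition lacunae : set (set R) :=
  [set connected_component (`[lend S, rend S] `\` fractal) x |
    x in `[lend S, rend S] `\` fractal].

(* The summands of H_l (left) and of H_f (right). *)
Definition summands : set (set R + nat * set R) :=
  [set u | match u with inl J => lacunae J | inr (n, J) => tiles n J end].

Definition interval_of (u : set R + nat * set R) : set R :=
  match u with inl J => J | inr (_, J) => J end.

(* The pairs (J, e), where J is a summand and e is an end of J: [false] stands
   for the left end, [true] for the right end. *)
Definition boundary_index : choiceType := (set_type summands * bool)%type.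

Definition boundary_point (i : boundary_index) : R :=
  if i.2 then sup (interval_of (val i.1)) else inf (interval_of (val i.1)).

Definition interval_length (i : boundary_index) : R :=
  sup (interval_of (val i.1)) - inf (interval_of (val i.1)).

Definition opposite_end (i : boundary_index) : boundary_index :=
  (i.1, ~~ i.2).

Local Notation H := (ell2 R boundary_index).

(* The graph of D: on its maximal domain, D acts on the summand l^2(dJ) by the
   matrix |J|^-1 [[0, 1], [1, 0]]. *)
Definition dirac_operator (xi eta : H) : Prop :=
  forall i, eta i = ((interval_length i)^-1)%:C * xi (opposite_end i).

(* The algebra Lip(F); functions on F are represented by functions on the line,
   whose values off F are irrelevant. *)
Definition lip_algebra (f : R -> R[i]) : Prop :=
  exists K : R, forall x y, fractal x -> fractal y ->
    normc (f x - f y) <= K * `|x - y|.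

(* The ends of the lacunae and of the tiles belong to F. *)
Definition representation (f : R -> R[i]) : H -> H :=
  multiplication (fun i => f (boundary_point i)).

Definition traceability_exponent (s : R) : Prop :=
  0 < s /\ exists tau : (H -> H) -> \bar R,
    singular_trace tau /\ (0 < tau (abs_power dirac_operator (- s)) < +oo)%E.

(* f |D|^-s *)
Definition besicovitch_operator (s : R) (f : R -> R[i]) : H -> H :=
  representation f \o abs_power dirac_operator (- s).

End Fractal.

Arguments dirac_operator {R} S _ _.
Arguments representation {R} S _ _.
Arguments besicovitch_operator {R} S _ _ _.

(* Main.v *)
(* The tiles of level n are permuted transitively by isometries of the line, since
   all of them are images of [a, b] under similarities of the same ratio. Such an
   isometry exchanges the parts of F lying in two tiles, and it exchanges the
   summands of the spectral triple lying in them while preserving the lengths of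
   the intervals. Hence all tiles of level n have the same Hausdorff measure, and,
   as only finitely many summands lie in no tile of level n while tau is unitarily
   invariant and kills finite rank operators, each tile receives the same share of
   tau(|D|^-s). For a Lipschitz function on F, both functionals thus differ from
   the average of the values of f at one point of each tile of level n by at most
   a constant times the length of these tiles, which is at most (b - a) / 2 ^ n. *)

From HB Require Import structures.
Require Import Defs.
From mathcomp Require Import all_boot all_order all_algebra.
From mathcomp Require Import complex ring lra.
From mathcomp Require Import all_classical all_reals all_analysis.
From mathcomp Require Import measurable_realfun.

Import Order.TTheory GRing.Theory Num.Theory.
Import numFieldNormedType.Exports.
Import ComplexField.Normc.
Local Open Scope classical_set_scope.
Local Open Scope complex_scope.
Local Open Scope ring_scope.

Set Implicit Arguments.
Unset Strict Implicit.
Unset Printing Implicit Defensive.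

Local Notation Re := complex.Re.
Local Notation Im := complex.Im.

(** * Unconditional sums and the Hilbert space *)

Section Sums.
Context {R : realType} {I : choiceType}.
Implicit Types (a b g : I -> R).

(** Two objects are defined by choice and have to be pinned down: [abs_power] selects some operator
    with the right action on eigenvectors, [trace_ext] selects some value. The sum and the
    difference of the two end vectors of an interval I are eigenvectors of D for plus and minus the
    inverse length; hence |D|^-s is the diagonal operator with entries |I|^s, f |D|^-s is diagonal
    too, and the argument stays within diagonal operators. Invariance of the trace under an isometry
    comes from tau(B A) = tau(A B) with B adjoint to A, where A combines an index permutation with
    the square root of the diagonal. The summands in no tile of level n are among the tiles of lower
    level and the lacunae whose left end is the right end of a tile of level n; a left end starts
    only one lacuna. On the measure side, equal shares require additivity on Borel sets, obtained
    from the Caratheodory criterion for rays, where right-continuity of h at 0 enters. Since all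
    comparisons rest on monotonicity, they are made for nonnegative Lipschitz functions and then
    applied to the positive and negative parts of Re f and Im f. *)

Lemma esumZl (k : R) a : 0 <= k -> (forall i, 0 <= a i) ->
  (\esum_(i in [set: I]) (k * a i)%:E = k%:E * \esum_(i in [set: I]) (a i)%:E)%E.
Proof.
move=> k0 a0; rewrite /esum -ereal_supZl//; last first.
  by apply/set0P; exists 0%E; exists set0; [exact: fsets_set0|rewrite fsbig_set0].
congr ereal_sup; rewrite image_comp; apply: eq_imagel => A [finA _] /=.
rewrite (eq_fsbigr (fun i => (k%:E * (a i)%:E)%E)); last first.
  by move=> i _; rewrite EFinM.
by rewrite -ge0_mule_fsumr// => i; rewrite lee_fin.
Qed.

Definition real_summable g := (\esum_(i in [set: I]) `|g i|%:E < +oo)%E.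

Lemma esum_fin_num a : (forall i, 0 <= a i) -> real_summable a ->
  (\esum_(i in [set: I]) (a i)%:E)%E \is a fin_num.
Proof.
move=> a0 sa; rewrite ge0_fin_numE; last first.
  by apply: esum_ge0 => i _; rewrite lee_fin.
apply: le_lt_trans sa; apply: le_esum => i _; rewrite lee_fin.
exact: ler_norm.
Qed.

Lemma le_real_summable a b : (forall i, `|a i| <= `|b i|) ->
  real_summable b -> real_summable a.
Proof. by move=> ab; apply: le_lt_trans; apply: le_esum => i _; rewrite lee_fin. Qed.

Lemma real_summableD a b :
  real_summable a -> real_summable b -> real_summable (fun i => a i + b i).
Proof.
move=> sa sb; apply: (@le_lt_trans _ _
   (\esum_(i in [set: I]) (`|a i|%:E + `|b i|%:E))%E).
  by apply: le_esum => i _; rewrite -EFinD lee_fin ler_normD.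
by rewrite esumD ?lte_add_pinfty// => i _; rewrite lee_fin.
Qed.

Lemma real_summableZ k a : real_summable a -> real_summable (fun i => k * a i).
Proof.
move=> sa; rewrite /real_summable.
under eq_esum do rewrite normrM.
by rewrite esumZl// lte_mul_pinfty// ?lee_fin.
Qed.

Lemma real_summableN a : real_summable a -> real_summable (fun i => - a i).
Proof. by apply: le_real_summable => i; rewrite normrN. Qed.

(** The positive and negative parts p and n of a - b satisfy p + b = n + a, an identity of
    nonnegative families that can be summed. So [rsum] may be computed from any splitting into
    nonnegative summable families, which gives its linearity. *)
Lemma rsum_diff a b : (forall i, 0 <= a i) -> (forall i, 0 <= b i) ->
  real_summable a -> real_summable b ->
  rsum (fun i => a i - b i) =
  fine (\esum_(i in [set: I]) (a i)%:E)%E - fine (\esum_(i in [set: I]) (b i)%:E)%E.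
Proof.
move=> a0 b0 sa sb; rewrite /rsum.
set p := fun i => Num.max (a i - b i) 0.
set n := fun i => Num.max (- (a i - b i)) 0.
have p0 i : 0 <= p i by rewrite le_max lexx orbT.
have n0 i : 0 <= n i by rewrite le_max lexx orbT.
have sab : real_summable (fun i => a i - b i).
  by apply: real_summableD => //; exact: real_summableN.
have sp : real_summable p.
  apply: le_real_summable sab => i; rewrite ger0_norm// /p ge_max ler_norm.
  exact: normr_ge0.
have sn : real_summable n.
  apply: le_real_summable sab => i; rewrite ger0_norm// /n ge_max.
  by rewrite -normrN ler_norm normr_ge0.
have : (\esum_(i in [set: I]) (p i)%:E + \esum_(i in [set: I]) (b i)%:E =
        \esum_(i in [set: I]) (n i)%:E + \esum_(i in [set: I]) (a i)%:E)%E.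
  rewrite -!esumD; try by move=> i _; rewrite lee_fin.
  apply: eq_esum => i _; rewrite -!EFinD; congr EFin.
  rewrite /p /n; case: (lerP 0 (a i - b i)) => h.
    have h' : - (a i - b i) <= 0 by rewrite oppr_le0.
    by rewrite (max_idPr h'); lra.
  have h' : 0 <= - (a i - b i) by rewrite oppr_ge0 ltW.
  by rewrite (max_idPl h'); lra.
move: (esum_fin_num p0 sp) (esum_fin_num n0 sn)
  (esum_fin_num a0 sa) (esum_fin_num b0 sb).
move=> /fineK <- /fineK <- /fineK <- /fineK <-.
by rewrite -!EFinD => -[] ?; rewrite /=; lra.
Qed.

Lemma rsum_split g : real_summable g -> exists a b,
  [/\ (forall i, 0 <= a i), (forall i, 0 <= b i), real_summable a,
      real_summable b & g = fun i => a i - b i].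
Proof.
move=> sg; exists (fun i => Num.max (g i) 0), (fun i => Num.max (- g i) 0).
split.
- by move=> i; rewrite le_max lexx orbT.
- by move=> i; rewrite le_max lexx orbT.
- apply: le_real_summable sg => i.
  by rewrite ger0_norm ?le_max ?lexx ?orbT// ge_max ler_norm normr_ge0.
- apply: le_real_summable sg => i.
  by rewrite ger0_norm ?le_max ?lexx ?orbT// ge_max -normrN ler_norm normr_ge0.
apply/funext => i; case: (lerP 0 (g i)) => h.
  have h' : - g i <= 0 by rewrite oppr_le0.
  by rewrite (max_idPr h') subr0.
have h' : 0 <= - g i by rewrite oppr_ge0 ltW.
by rewrite (max_idPl h'); lra.
Qed.

Lemma rsumD f g : real_summable f -> real_summable g ->
  rsum (fun i => f i + g i) = rsum f + rsum g.
Proof.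
move=> /rsum_split[a [b [a0 b0 sa sb ->]]] /rsum_split[c [d [c0 d0 sc sd ->]]].
rewrite !rsum_diff//.
have -> : (fun i => a i - b i + (c i - d i)) = (fun i => (a i + c i) - (b i + d i)).
  by apply/funext => i; ring.
rewrite rsum_diff; try by move=> i; rewrite addr_ge0.
- under eq_esum do rewrite EFinD.
  rewrite esumD; try by move=> i _; rewrite lee_fin.
  under [X in _ - fine X]eq_esum do rewrite EFinD.
  rewrite (esumD (a := fun i => (b i)%:E)); try by move=> i _; rewrite lee_fin.
  move: (esum_fin_num a0 sa) (esum_fin_num b0 sb)
    (esum_fin_num c0 sc) (esum_fin_num d0 sd).
  by move=> /fineK <- /fineK <- /fineK <- /fineK <- /=; ring.
- exact: real_summableD.
- exact: real_summableD.
Qed.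

Lemma rsumN g : rsum (fun i => - g i) = - rsum g.
Proof.
rewrite /rsum opprB; congr (_ - fine _).
by apply: eq_esum => i _; rewrite opprK.
Qed.

Lemma rsumZ k g : real_summable g -> rsum (fun i => k * g i) = k * rsum g.
Proof.
wlog k0 : k / 0 <= k => [hw sg|].
  case: (lerP 0 k) => h; first exact: hw.
  rewrite -[k]opprK.
  have -> : (fun i => - - k * g i) = (fun i => - (- k * g i)).
    by apply/funext => i; rewrite mulNr.
  have nk : 0 <= - k by rewrite oppr_ge0 ltW.
  by rewrite rsumN (hw _ nk sg); ring.
move=> /rsum_split[a [b [a0 b0 sa sb ->]]]; rewrite rsum_diff//.
have -> : (fun i => k * (a i - b i)) = (fun i => k * a i - k * b i).
  by apply/funext => i; rewrite mulrBr.
rewrite rsum_diff//; try by move=> i; rewrite mulr_ge0.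
- rewrite !esumZl//.
  move: (esum_fin_num a0 sa) (esum_fin_num b0 sb).
  by move=> /fineK <- /fineK <- /=; rewrite mulrBr.
- exact: real_summableZ.
- exact: real_summableZ.
Qed.

Lemma rsum_ge0E a : (forall i, 0 <= a i) ->
  rsum a = fine (\esum_(i in [set: I]) (a i)%:E)%E.
Proof.
move=> a0; rewrite /rsum [X in _ - fine X]esum1 => [|i _]; last first.
  by apply/congr1/max_idPr; rewrite oppr_le0.
rewrite subr0; congr fine; apply: eq_esum => i _; congr EFin.
exact/max_idPl.
Qed.

Lemma rsum0 : rsum (fun _ : I => 0 : R) = 0.
Proof. by rewrite rsum_ge0E// esum1. Qed.

Lemma rsum_reindex (e : I -> I) g : bijective e ->
  rsum (fun i => g (e i)) = rsum g.
Proof.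
move=> be.
have eb : set_bij [set: I] [set: I] e by rewrite setTT_bijective.
by rewrite /rsum; congr (fine _ - fine _); rewrite [RHS](reindex_esum _ _ _ _ eb).
Qed.

Definition complex_summable (g : I -> R[i]) :=
  real_summable (fun i => Re (g i)) /\ real_summable (fun i => Im (g i)).

Lemma csumD (f g : I -> R[i]) :
  complex_summable f -> complex_summable g ->
  csum (fun i => f i + g i) = csum f + csum g.
Proof.
move=> [a b] [c d]; rewrite /csum.
rewrite (_ : (fun i => Re (f i + g i)) = (fun i => Re (f i) + Re (g i))); last first.
  by apply/funext => i; rewrite raddfD.
rewrite (_ : (fun i => Im (f i + g i)) = (fun i => Im (f i) + Im (g i))); last first.
  by apply/funext => i; rewrite raddfD.
by rewrite !rsumD.
Qed.

Lemma csumZ (k : R[i]) (g : I -> R[i]) : complex_summable g ->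
  csum (fun i => k * g i) = k * csum g.
Proof.
case: k => x y [a b]; rewrite /csum.
rewrite (_ : (fun i => Re _) =
    (fun i => x * Re (g i) + - (y * Im (g i)))); last first.
  by apply/funext => i; case: (g i).
rewrite (_ : (fun i => Im _) = (fun i => x * Im (g i) + y * Re (g i))); last first.
  by apply/funext => i; case: (g i).
have sZ (r : R) f := @real_summableZ r f.
rewrite (@rsumD (fun i => x * Re (g i)) (fun i => - (y * Im (g i)))); last 2 first.
- exact: sZ.
- by apply: real_summableN; exact: sZ.
rewrite (rsumN (fun i => y * Im (g i))).
rewrite (@rsumD (fun i => x * Im (g i)) (fun i => y * Re (g i))); [|exact: sZ..].
rewrite (rsumZ x a) (rsumZ y b) (rsumZ x b) (rsumZ y a).
by [].
Qed.

Lemma csum_reindex (e : I -> I) (g : I -> R[i]) : bijective e ->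
  csum (fun i => g (e i)) = csum g.
Proof.
move=> be; rewrite /csum (@rsum_reindex e (fun i => Re (g i)) be).
by rewrite (@rsum_reindex e (fun i => Im (g i)) be).
Qed.

End Sums.

Section InnerProduct.
Context {R : realType} {I : choiceType}.
Local Notation H := (ell2 R I).
Implicit Types (xi eta zeta : H).

Lemma ell2P xi eta : (forall i, xi i = eta i) -> xi = eta.
Proof. by move=> e; apply: val_inj; apply/funext. Qed.

Lemma ell2_sqsum_lty xi : (sqsum xi < +oo)%E.
Proof. by have := valP xi; rewrite inE. Qed.

Lemma ell2_addE xi eta i : (xi + eta) i = xi i + eta i. Proof. by []. Qed.
Lemma ell2_oppE xi i : (- xi) i = - xi i. Proof. by []. Qed.
Lemma ell2_scaleE c xi i : (c *: xi) i = c * xi i. Proof. by []. Qed.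
Lemma normc2_ge0 (z : R[i]) : 0 <= normc z ^+ 2.
Proof. exact: sqr_ge0. Qed.

(** A crude termwise Cauchy-Schwarz bound; it makes the family defining [inner] absolutely
    summable. *)
Lemma Re_Im_le (x y : R[i]) :
  `|Re (conjc x * y)| <= normc x ^+ 2 + normc y ^+ 2 /\
  `|Im (conjc x * y)| <= normc x ^+ 2 + normc y ^+ 2.
Proof.
case: x y => a b [c d]; rewrite !normc2E /=.
have sq (u v : R) : 0 <= (u + v) ^+ 2 /\ 0 <= (u - v) ^+ 2 by rewrite !sqr_ge0.
have [? ?] := sq a c; have [? ?] := sq b d.
have [? ?] := sq a d; have [? ?] := sq b c.
have [? ?] := sq a b; have [? ?] := sq c d.
by split; rewrite ler_norml; apply/andP; split; nra.
Qed.

Lemma real_summable_normc2 xi : real_summable (fun i => normc (xi i) ^+ 2).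
Proof.
apply: le_lt_trans (ell2_sqsum_lty xi); apply: le_esum => i _.
by rewrite lee_fin ger0_norm// normc2_ge0.
Qed.

Lemma inner_summable xi eta : complex_summable (fun i => conjc (xi i) * eta i).
Proof.
have s : real_summable (fun i => normc (xi i) ^+ 2 + normc (eta i) ^+ 2).
  by apply: real_summableD; exact: real_summable_normc2.
by split; apply: le_real_summable s => i;
  rewrite [leRHS]ger0_norm ?addr_ge0 ?normc2_ge0//; have [] := Re_Im_le (xi i) (eta i).
Qed.

Lemma innerDr xi eta zeta : inner xi (eta + zeta) = inner xi eta + inner xi zeta.
Proof.
rewrite /inner -csumD; try exact: inner_summable.
by congr csum; apply/funext => i; rewrite ell2_addE mulrDr.
Qed.

Lemma innerZr c xi eta : inner xi (c *: eta) = c * inner xi eta.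
Proof.
rewrite /inner -csumZ; last exact: inner_summable.
by congr csum; apply/funext => i; rewrite ell2_scaleE mulrCA.
Qed.

Lemma innerC xi eta : inner xi eta = conjc (inner eta xi).
Proof.
rewrite /inner /csum /=; congr (_ +i* _).
  by congr rsum; apply/funext => i; case: (xi i) (eta i) => a b [c d] /=; ring.
rewrite -rsumN; congr rsum; apply/funext => i.
by case: (xi i) (eta i) => a b [c d] /=; ring.
Qed.

Lemma innerDl xi eta zeta : inner (xi + eta) zeta = inner xi zeta + inner eta zeta.
Proof.
by rewrite innerC innerDr (innerC xi zeta) (innerC eta zeta); exact: rmorphD.
Qed.

Lemma innerZl c xi eta : inner (c *: xi) eta = conjc c * inner xi eta.
Proof. by rewrite innerC innerZr (innerC xi eta); exact: rmorphM. Qed.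

Lemma sqsum_ge0 xi : (0 <= sqsum xi)%E.
Proof. by apply: esum_ge0 => i _; rewrite lee_fin normc2_ge0. Qed.

Lemma le_sqsum xi i : ((normc (xi i) ^+ 2)%:E <= sqsum xi)%E.
Proof.
apply: esum_ge; exists [set i]; first by split.
by rewrite fsbig_set1.
Qed.

Lemma inner_eq0 xi : inner xi xi = 0 -> xi = 0.
Proof.
move=> /(congr1 (@complex.Re R)) /= h; apply: ell2P => i.
have e : (fun i => Re (conjc (xi i) * xi i)) = (fun i => normc (xi i) ^+ 2).
  by apply/funext => j; rewrite normc2E; case: (xi j) => a b /=; ring.
have {}h : sqsum xi = 0%E.
  move: h; rewrite e rsum_ge0E => [h|j]; last exact: normc2_ge0.
  have /fineK <- : sqsum xi \is a fin_num.
    by rewrite ge0_fin_numE ?ell2_sqsum_lty// sqsum_ge0.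
  by rewrite h.
have := le_sqsum xi i; rewrite h lee_fin => h'.
have /eqP : normc (xi i) ^+ 2 = 0 by apply/eqP; rewrite eq_le h' normc2_ge0.
by rewrite sqrf_eq0 => /eqP /eq0_normc.
Qed.

(** Polarization: with eta := X xi, the form at xi + eta and at xi + i eta shows that the sum and
    the difference of <xi, X eta> and <eta, X xi> vanish, so <X xi, X xi> = 0. Complex scalars are
    essential, since a quarter turn of the real plane has zero form. *)
Lemma eq0_of_quadratic_form (X : H -> H) :
  (forall xi eta, X (xi + eta) = X xi + X eta) ->
  (forall c xi, X (c *: xi) = c *: X xi) ->
  (forall xi, inner xi (X xi) = 0) -> X = fun _ => 0.
Proof.
move=> XD XZ X0; apply/funext => xi; apply: inner_eq0.
set eta := X xi.
have h1 : inner xi (X eta) + inner eta (X xi) = 0.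
  by have := X0 (xi + eta); rewrite XD innerDl !innerDr !X0 add0r addr0.
have h2 : 'i%C * inner xi (X eta) - 'i%C * inner eta (X xi) = 0.
  have := X0 (xi + 'i%C *: eta).
  rewrite XD XZ innerDl !innerDr !innerZl !innerZr !X0 add0r !mulr0 addr0.
  rewrite (_ : conjc 'i%C = - 'i%C); last first.
    by apply/eqP; rewrite eq_complex /= oppr0 !eqxx.
  by rewrite mulNr.
have h3 : 'i%C * (inner eta (X xi) *+ 2) = 0 :> R[i].
  move: h1 h2 => /eqP; rewrite addr_eq0 => /eqP -> /eqP.
  rewrite mulrN -opprD oppr_eq0 => /eqP h2.
  by rewrite mulr2n mulrDr.
move/eqP: h3; rewrite mulf_eq0 mulrn_eq0 /=.
case/orP => [/eqP/(congr1 (@complex.Im R))/= /eqP|/eqP//].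
by rewrite oner_eq0.
Qed.

End InnerProduct.

(** * Weighted compositions and real diagonal operators *)

Section Operators.
Context {R : realType} {I : choiceType}.
Local Notation H := (ell2 R I).
Implicit Types (xi eta : H) (c : I -> R[i]) (d : I -> R) (e : I -> I).

Lemma l2norm_le (M : R) xi eta : (sqsum eta <= (M ^+ 2)%:E * sqsum xi)%E ->
  l2norm eta <= `|M| * l2norm xi.
Proof.
have fx (z : H) : sqsum z \is a fin_num.
  by rewrite ge0_fin_numE ?ell2_sqsum_lty// sqsum_ge0.
rewrite /l2norm -(fineK (fx xi)) -(fineK (fx eta)) -EFinM lee_fin => h.
rewrite -sqrtr_sqr -sqrtrM ?sqr_ge0//.
exact: ler_wsqrtr.
Qed.

Lemma normc_le_l2norm xi i : normc (xi i) <= l2norm xi.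
Proof.
have fx : sqsum xi \is a fin_num.
  by rewrite ge0_fin_numE ?ell2_sqsum_lty// sqsum_ge0.
have := le_sqsum xi i; rewrite -(fineK fx) lee_fin => h.
have n0 : 0 <= normc (xi i) by case: (xi i) => a b /=; rewrite sqrtr_ge0.
by rewrite /l2norm -[leLHS]ger0_norm// -sqrtr_sqr ler_wsqrtr.
Qed.

(** One family containing both the diagonal operators ([e] the identity) and the permutations of the
    basis ([c] constant 1). The default 0 of [insubd] does not occur when [c] is bounded and [e]
    bijective. *)
Definition weighted_composition c e xi : H := insubd (0 : H) (fun i => c i * xi (e i)).

Lemma sqsum_weighted_composition c e M xi : bijective e ->
  (forall i, normc (c i) <= M) ->
  (sqsum (fun i => c i * xi (e i))%R <= (M ^+ 2)%:E * sqsum xi)%E.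
Proof.
move=> be cM.
have eb : set_bij [set: I] [set: I] e by rewrite setTT_bijective.
rewrite /sqsum [X in (_ * X)%E](reindex_esum _ _ _ _ eb).
rewrite -esumZl ?sqr_ge0//; last by move=> i; exact: sqr_ge0.
apply: le_esum => i _; rewrite lee_fin normcM exprMn.
apply: ler_wpM2r; first exact: sqr_ge0.
have n0 : 0 <= normc (c i) by case: (c i) => a b /=; rewrite sqrtr_ge0.
by rewrite ler_sqr ?nnegrE// (le_trans n0).
Qed.

Lemma weighted_compositionE c e M xi i : bijective e ->
  (forall i, normc (c i) <= M) -> weighted_composition c e xi i = c i * xi (e i).
Proof.
move=> be cM; rewrite /weighted_composition.
have h : (fun i => c i * xi (e i)) \in @sqsummable R I.
  rewrite inE; apply: le_lt_trans (sqsum_weighted_composition xi be cM) _.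
  by rewrite lte_mul_pinfty ?lee_fin ?sqr_ge0// ell2_sqsum_lty.
by rewrite -[LHS]/(\val (insubd (0 : H) (fun i => c i * xi (e i))) i) insubdK.
Qed.

Lemma weighted_composition_bounded c e M : bijective e ->
  (forall i, normc (c i) <= M) -> bounded_operator (weighted_composition c e).
Proof.
move=> be cM; split.
  move=> k xi eta; apply: ell2P => i.
  rewrite ell2_addE ell2_scaleE !(weighted_compositionE _ _ be cM).
  by rewrite ell2_addE ell2_scaleE mulrDr mulrCA.
exists `|M| => xi; apply: l2norm_le.
have -> : sqsum (weighted_composition c e xi) = sqsum (fun i => c i * xi (e i)).
  by congr sqsum; apply/funext => i; rewrite (weighted_compositionE _ _ be cM).
exact: sqsum_weighted_composition.
Qed.

Lemma weighted_composition_adjoint c e e' M : cancel e e' -> cancel e' e ->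
  (forall i, normc (c i) <= M) ->
  adjoint_pair (weighted_composition c e)
    (weighted_composition (fun j => conjc (c (e' j))) e').
Proof.
move=> ee' e'e cM xi eta.
have be : bijective e by exists e'.
have be' : bijective e' by exists e.
have cM' i : normc (conjc (c (e' i))) <= M.
  by have := cM (e' i); case: (c (e' i)) => a b /=; rewrite sqrrN.
rewrite /inner -[RHS](csum_reindex _ be); congr csum; apply/funext => i.
rewrite (weighted_compositionE _ _ be cM) (weighted_compositionE _ _ be' cM') ee'.
by rewrite rmorphM mulrCA mulrA.
Qed.

Definition bounded_weight d := exists M, forall i, `|d i| <= M.

Definition rdiag d : H -> H := multiplication (fun i => (d i)%:C).

Lemma normc_real (x : R) : normc x%:C = `|x|.
Proof. by rewrite /= expr0n addr0 sqrtr_sqr. Qed.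

Lemma rdiagE d xi i : bounded_weight d -> rdiag d xi i = (d i)%:C * xi i.
Proof.
move=> [M dM]; apply: (@weighted_compositionE _ id M).
- by exists id.
- by move=> j; rewrite normc_real.
Qed.

Lemma rdiag_bounded d : bounded_weight d -> bounded_operator (rdiag d).
Proof.
move=> [M dM]; apply: (@weighted_composition_bounded _ id M); first by exists id.
by move=> i; rewrite normc_real.
Qed.

Lemma rdiag_positive d : (forall i, 0 <= d i) -> bounded_weight d ->
  positive_operator (rdiag d).
Proof.
move=> d0 bd; split; first exact: rdiag_bounded.
move=> xi; rewrite /inner.
have -> : (fun i => conjc (xi i) * rdiag d xi i) =
    (fun i => (d i * normc (xi i) ^+ 2)%:C).
  apply/funext => i; rewrite rdiagE// normc2E; case: (xi i) => a b /=.
  by apply/eqP; rewrite eq_complex /=; apply/andP; split; apply/eqP; ring.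
rewrite /csum lecE /=.
rewrite rsum0 eqxx /= rsum_ge0E => [|i]; last by rewrite mulr_ge0// normc2_ge0.
by rewrite fine_ge0// esum_ge0// => i _; rewrite lee_fin mulr_ge0// normc2_ge0.
Qed.

Lemma bounded_weightD a b :
  bounded_weight a -> bounded_weight b -> bounded_weight (fun i => a i + b i).
Proof.
move=> [M aM] [N bN]; exists (M + N) => i.
by rewrite (le_trans (ler_normD _ _))// lerD.
Qed.

Lemma bounded_weightM a b :
  bounded_weight a -> bounded_weight b -> bounded_weight (fun i => a i * b i).
Proof.
move=> [M aM] [N bN]; exists (M * N) => i.
by rewrite normrM ler_pM.
Qed.

Lemma bounded_weight_cst k : bounded_weight (fun=> k).
Proof. by exists `|k|. Qed.

Lemma le_bounded_weight a b : (forall i, 0 <= a i <= b i) ->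
  bounded_weight b -> bounded_weight a.
Proof.
move=> ab [M bM]; exists M => i; have /andP[a0 aib] := ab i.
by rewrite ger0_norm// (le_trans _ (bM i))// (le_trans aib) ?ler_norm.
Qed.

Lemma rdiagD a b : bounded_weight a -> bounded_weight b ->
  rdiag (fun i => a i + b i) = rdiag a + rdiag b.
Proof.
move=> ba bb; apply/funext => xi; apply: ell2P => i.
rewrite -[RHS]/((rdiag a xi + rdiag b xi) i) ell2_addE !rdiagE//.
  by rewrite rmorphD mulrDl.
exact: bounded_weightD.
Qed.

Lemma rdiagZ k a : bounded_weight a ->
  rdiag (fun i => k * a i) = k%:C *: rdiag a.
Proof.
move=> ba; apply/funext => xi; apply: ell2P => i.
rewrite -[RHS]/((k%:C *: rdiag a xi) i) ell2_scaleE !rdiagE//.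
  by rewrite rmorphM mulrA.
by apply: bounded_weightM => //; exact: bounded_weight_cst.
Qed.

End Operators.

(** * Finitely supported vectors and finite rank projections *)

Section Density.
Context {R : realType} {I : choiceType}.
Local Notation H := (ell2 R I).
Implicit Types (xi eta : H).

Definition delta (i : I) : H :=
  insubd (0 : H) (fun j => if j == i then 1 else 0).

Lemma deltaE i j : delta i j = if j == i then 1 else 0.
Proof.
have h : (fun j => if j == i then 1 else 0) \in @sqsummable R I.
  rewrite inE /sqsum (esumID [set i]) => [|k _]; last by rewrite lee_fin normc2_ge0.
  rewrite setTI [X in (_ + X)%E]esum1 => [|k [_ /= /eqP/negbTE ->]]; last first.
    by rewrite normc0 expr0n.
  by rewrite adde0 esum_set1 ?lee_fin ?normc2_ge0// ltry.
by rewrite -[LHS]/(\val (insubd (0 : H) (fun j => if j == i then 1 else 0)) j) insubdK.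
Qed.

Lemma ell2_sumE n (F : 'I_n -> H) i : (\sum_(k < n) F k) i = \sum_(k < n) F k i.
Proof.
by apply: (big_ind2 (fun (x : H) y => x i = y)) => // x _ z _ <- <-.
Qed.

Lemma bounded_indic (A : set I) : bounded_weight (\1_A : I -> R).
Proof. by exists 1 => i; rewrite indicE; case: (_ \in _); rewrite ?normr1 ?normr0. Qed.

Lemma rdiag_indicE (A : set I) xi i :
  rdiag \1_A xi i = if i \in A then xi i else 0.
Proof.
rewrite rdiagE; last exact: bounded_indic.
by rewrite indicE; case: (i \in A); rewrite ?mul1r ?mul0r.
Qed.

Lemma rdiag_finite_sum (A : set I) : finite_set A ->
  exists (n : nat) (t : 'I_n -> I), forall xi,
    rdiag \1_A xi = \sum_(k < n) xi (t k) *: delta (t k).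
Proof.
move=> /finite_seqP[s0 As]; pose s := undup s0.
have memA i : (i \in A) = (i \in s).
  by rewrite mem_undup As; apply/idP/idP; rewrite inE.
exists (size s), (tnth (in_tuple s)) => xi; apply: ell2P => i.
rewrite rdiag_indicE ell2_sumE.
under eq_bigr do rewrite ell2_scaleE deltaE.
rewrite -(big_tnth _ _ s xpredT (fun j => xi j * (if i == j then 1 else 0))).
case: ifPn => iA.
  rewrite (bigD1_seq i) ?undup_uniq -?memA//= eqxx mulr1 big1 ?addr0// => j.
  by rewrite eq_sym => /negbTE ->; rewrite mulr0.
rewrite big_seq big1// => j js; case: eqP => [ij|]; last by rewrite mulr0.
by move: iA js; rewrite -ij -memA => /negbTE ->.
Qed.

Lemma rdiag_indic_projection (A : set I) : finite_set A ->
  finite_rank_projection (rdiag (\1_A : I -> R)).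
Proof.
move=> finA; have [n [t tE]] := rdiag_finite_sum finA; split.
- exact/rdiag_bounded/bounded_indic.
- apply/funext => xi; apply: ell2P => i; rewrite /= !rdiag_indicE.
  by case: (i \in A).
- move=> xi eta; rewrite /inner; congr csum; apply/funext => i.
  by rewrite !rdiag_indicE; case: ifP; rewrite ?rmorph0 ?mul0r ?mulr0.
- exists n, (fun k => delta (t k)) => xi; exists (fun k => xi (t k)).
  exact: tE.
Qed.

(** [sqsum] is a supremum of finite partial sums; a finite set that comes within [ep] of it leaves
    at most [ep] for the complement. *)
Lemma sqsum_tail xi (ep : R) : 0 < ep ->
  exists2 A : set I, finite_set A & (sqsum (xi - rdiag \1_A xi)%R <= ep%:E)%E.
Proof.
move=> ep0.
have fx : sqsum xi \is a fin_num.
  by rewrite ge0_fin_numE ?ell2_sqsum_lty// sqsum_ge0.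
have [_ [A [finA _] <-] hA] := ub_ereal_sup_adherent ep0 fx.
exists A => //.
have hs : sqsum xi = (\sum_(i \in A) (normc (xi i) ^+ 2)%:E + sqsum (xi - rdiag \1_A xi)%R)%E.
  rewrite {1}/sqsum (esumID A) => [|i _]; last by rewrite lee_fin normc2_ge0.
  rewrite setTI setTI; congr (_ + _)%E.
    by rewrite -esum_fset// => i _; rewrite lee_fin normc2_ge0.
  rewrite esum_mkcond; apply: eq_esum => i _.
  rewrite ell2_addE ell2_oppE rdiag_indicE in_setC.
  case: (i \in A) => /=; last by rewrite subr0.
  by rewrite subrr normc0 expr0n.
move: hA; rewrite [X in (X - _)%E](_ : _ = sqsum xi)// hs.
have f1 : (\sum_(i \in A) (normc (xi i) ^+ 2)%:E)%E \is a fin_num.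
  rewrite hs in fx; move: fx; rewrite fin_numD => /andP[] //.
have f2 : sqsum (xi - rdiag \1_A xi) \is a fin_num.
  by rewrite hs in fx; move: fx; rewrite fin_numD => /andP[].
rewrite -(fineK f1) -(fineK f2) -!EFinD lte_fin lee_fin.
lra.
Qed.

Lemma bounded_operator_sum (T : H -> H) n (c : 'I_n -> R[i]) (F : 'I_n -> H) :
  bounded_operator T -> T (\sum_(k < n) c k *: F k) = \sum_(k < n) c k *: T (F k).
Proof.
move=> [linT _].
have T0 : T 0 = 0.
  have := linT 0 0 0; rewrite !scale0r addr0 add0r => h.
  by apply/(addrI (T 0)); rewrite addr0 -{1}[T 0]scale1r -(linT 1) scale1r addr0.
elim: n c F => [|n ih] c F; first by rewrite !big_ord0.
by rewrite !big_ord_recr /= addrC linT ih addrC.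
Qed.

(** By linearity the operators agree on truncations of xi to finite sets; on the remaining tail both
    are small, by their norm bounds. *)
Lemma bounded_operator_ext (T U : H -> H) :
  bounded_operator T -> bounded_operator U ->
  (forall i, T (delta i) = U (delta i)) -> T = U.
Proof.
move=> bT bU TU; apply/funext => xi; apply: ell2P => j.
have [linT [M TM]] := bT; have [linU [N UN]] := bU.
have TA A : finite_set A -> T (rdiag \1_A xi) = U (rdiag \1_A xi).
  move=> /rdiag_finite_sum[n [t ->]]; rewrite !bounded_operator_sum//.
  by apply: eq_bigr => k _; rewrite TU.
apply/eqP; rewrite -subr_eq0; apply/eqP/eq0_normc/eqP.
rewrite eq_le; apply/andP; split; last first.
  by case: (_ - _) => a b /=; rewrite sqrtr_ge0.
apply/ler_addgt0Pl => e e0; rewrite addr0.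
(* The summand 1 keeps [K] positive when both bounds vanish. The tail is taken with squared norm at
   most (e / K) ^ 2, so that T and U together contribute at most e. *)
pose K := `|M| + `|N| + 1.
have K0 : 0 < K by rewrite ltr_wpDl// addr_ge0.
have [A finA hA] := @sqsum_tail xi ((e / K) ^+ 2) (exprn_gt0 2 (divr_gt0 e0 K0)).
set eta := xi - rdiag \1_A xi in hA.
have eeta : l2norm eta <= e / K.
  have fx : sqsum eta \is a fin_num.
    by rewrite ge0_fin_numE ?ell2_sqsum_lty// sqsum_ge0.
  move: hA; rewrite -(fineK fx) lee_fin => /(ler_wsqrtr).
  by rewrite sqrtr_sqr ger0_norm// ltW// divr_gt0.
have -> : T xi j - U xi j = T eta j - U eta j.
  have xiE : xi = 1 *: rdiag \1_A xi + eta by rewrite scale1r /eta addrC subrK.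
  rewrite {1 2}xiE linT linU TA// !ell2_addE !scale1r; ring.
apply: le_trans (le_normcD _ _) _.
rewrite normcN.
have h1 : normc (T eta j) <= `|M| * (e / K).
  apply: le_trans (normc_le_l2norm _ _) _; apply: le_trans (TM _) _.
  apply: le_trans (ler_norm _) _; rewrite normrM ler_wpM2l//.
  by rewrite ger0_norm// sqrtr_ge0.
have h2 : normc (U eta j) <= `|N| * (e / K).
  apply: le_trans (normc_le_l2norm _ _) _; apply: le_trans (UN _) _.
  apply: le_trans (ler_norm _) _; rewrite normrM ler_wpM2l//.
  by rewrite ger0_norm// sqrtr_ge0.
apply: le_trans (lerD h1 h2) _; rewrite -mulrDl.
rewrite mulrA ler_pdivrMr// mulrC ler_wpM2l// ?(ltW e0)//.
by rewrite /K ler_wpDr.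
Qed.

End Density.

(** * Singular traces of diagonal operators *)

Section SingularTrace.
Context {R : realType} {I : choiceType}.
Local Notation H := (ell2 R I).
Variables (tau : (H -> H) -> \bar R) (tau_singular : singular_trace tau).
Implicit Types (a b d w : I -> R).

Lemma trace_ge0 a : (forall i, 0 <= a i) -> bounded_weight a ->
  (0 <= tau (rdiag a))%E.
Proof. by move=> a0 ba; have [+ _ _ _ _] := tau_singular; apply; exact: rdiag_positive. Qed.

Lemma trace_add a b : (forall i, 0 <= a i) -> (forall i, 0 <= b i) ->
  bounded_weight a -> bounded_weight b ->
  tau (rdiag (fun i => a i + b i)) = (tau (rdiag a) + tau (rdiag b))%E.
Proof.
move=> a0 b0 ba bb; rewrite rdiagD//.
by have [_ + _ _ _] := tau_singular; apply; exact: rdiag_positive.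
Qed.

Lemma trace_scale (k : R) a : 0 <= k -> (forall i, 0 <= a i) -> bounded_weight a ->
  tau (rdiag (fun i => k * a i)) = (k%:E * tau (rdiag a))%E.
Proof.
move=> k0 a0 ba; rewrite rdiagZ//.
by have [_ _ + _ _] := tau_singular; apply => //; exact: rdiag_positive.
Qed.

Lemma trace_le a b : (forall i, 0 <= a i <= b i) -> bounded_weight b ->
  (tau (rdiag a) <= tau (rdiag b))%E.
Proof.
move=> ab bb.
have ba : bounded_weight a by exact: le_bounded_weight bb.
have a0 i : 0 <= a i by have /andP[] := ab i.
have ba0 i : 0 <= b i - a i by rewrite subr_ge0; have /andP[] := ab i.
have bba : bounded_weight (fun i => b i - a i).
  apply: le_bounded_weight bb => i; rewrite ba0 /=.
  by rewrite gerBl.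
have -> : b = (fun i => a i + (b i - a i)) by apply/funext => i; ring.
by rewrite trace_add// leeDl// trace_ge0.
Qed.

(** The diagonal operator is dominated by a multiple of the projection onto the coordinates in A,
    whose trace is 0 by singularity. *)
Lemma trace_finite_support a (A : set I) : finite_set A -> (forall i, 0 <= a i) ->
  bounded_weight a -> (forall i, ~ A i -> a i = 0) -> tau (rdiag a) = 0%E.
Proof.
move=> finA a0 [M aM] aA.
apply/eqP; rewrite eq_le trace_ge0 ?andbT//; last by exists M.
have -> : (0 = (`|M|%:E * tau (rdiag \1_A)))%E.
  have [_ _ _ _ ->] := tau_singular; first by rewrite mule0.
  exact: rdiag_indic_projection.
rewrite -trace_scale//; last exact: bounded_indic.
apply: trace_le; last first.
  by apply: bounded_weightM; [exact: bounded_weight_cst|exact: bounded_indic].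
move=> i; rewrite a0 /= indicE; case: (boolP (i \in A)) => iA.
  rewrite mulr1 (le_trans (ler_norm _))// (le_trans (aM i))//.
  exact: ler_norm.
by rewrite mulr0 aA//; move: iA; rewrite notin_setE.
Qed.

(** Let V be the composition with e' weighted by the square root of a, and W its adjoint. Then V W
    is the diagonal operator of a and W V that of a o e, so the trace property for adjoint pairs
    applies. *)
Lemma trace_reindex a (e e' : I -> I) : cancel e e' -> cancel e' e ->
  (forall i, 0 <= a i) -> bounded_weight a ->
  tau (rdiag (a \o e)) = tau (rdiag a).
Proof.
move=> ee' e'e a0 [M aM].
pose c i := (Num.sqrt (a i))%:C : R[i].
have cM i : normc (c i) <= Num.sqrt M.
  rewrite normc_real ger0_norm ?sqrtr_ge0// ler_wsqrtr//.
  by rewrite (le_trans _ (aM i))// ler_norm.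
have cM' i : normc (conjc (c (e i))) <= Num.sqrt M.
  by have := cM (e i); rewrite /c /= oppr0.
have cc i : c i * conjc (c i) = (a i)%:C.
  rewrite /c /=; apply/eqP; rewrite eq_complex /=; apply/andP; split; apply/eqP.
    by rewrite oppr0 mulr0 subr0 -expr2 sqr_sqrtr.
  by rewrite oppr0 mulr0 mul0r addr0.
have be : bijective e by exists e'.
have be' : bijective e' by exists e.
pose V := weighted_composition c e'.
pose W := weighted_composition (fun j => conjc (c (e j))) e.
have VE xi i : V xi i = c i * xi (e' i).
  by rewrite /V (weighted_compositionE _ _ be' cM).
have WE xi i : W xi i = conjc (c (e i)) * xi (e i).
  by rewrite /W (weighted_compositionE _ _ be cM').
have bA : bounded_weight a by exists M.
have bAe : bounded_weight (a \o e) by exists M => i; exact: aM.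
have -> : rdiag (a \o e) = W \o V.
  apply/funext => xi; apply: ell2P => i.
  by rewrite rdiagE//= WE VE ee' mulrA (mulrC (conjc _)) cc.
have -> : rdiag a = V \o W.
  apply/funext => xi; apply: ell2P => i.
  by rewrite rdiagE//= VE WE e'e mulrA cc.
have [_ _ _ + _] := tau_singular; apply.
- exact: weighted_composition_bounded be' cM.
- exact: weighted_composition_bounded be cM'.
- exact: weighted_composition_adjoint cM.
Qed.

Lemma trace_sum (T : eqType) (s : seq T) (F : T -> I -> R) :
  (forall t, t \in s -> forall i, 0 <= F t i) ->
  (forall t, t \in s -> bounded_weight (F t)) ->
  tau (rdiag (fun i => \sum_(t <- s) F t i)) = (\sum_(t <- s) tau (rdiag (F t)))%E.
Proof.
elim: s => [|t s ih] F0 bF.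
  rewrite big_nil; under eq_fun do rewrite big_nil.
  apply: (@trace_finite_support _ set0) => //; exact: bounded_weight_cst.
rewrite big_cons; under eq_fun do rewrite big_cons.
have F0s u : u \in s -> forall i, 0 <= F u i.
  by move=> us; apply: F0; rewrite inE us orbT.
have bFs u : u \in s -> bounded_weight (F u).
  by move=> us; apply: bF; rewrite inE us orbT.
rewrite trace_add ?ih//.
- by apply: F0; rewrite inE eqxx.
- by move=> i; rewrite big_seq sumr_ge0// => u us; exact: F0s.
- by apply: bF; rewrite inE eqxx.
- elim: s bFs {ih F0 bF F0s} => [|u s ih] bFs.
    by under eq_fun do rewrite big_nil; exact: bounded_weight_cst.
  under eq_fun do rewrite big_cons; apply: bounded_weightD.
    by apply: bFs; rewrite inE eqxx.
  by apply: ih => v vs; apply: bFs; rewrite inE vs orbT.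
Qed.

Lemma positive_operator_linear (A : H -> H) : positive_operator A ->
  (forall xi eta, A (xi + eta) = A xi + A eta) /\
  (forall c xi, A (c *: xi) = c *: A xi).
Proof.
move=> [[linA _] _].
have A0 : A 0 = 0.
  have := linA 1 0 0; rewrite !scale1r addr0 => /esym h.
  by apply: (addrI (A 0)); rewrite addr0.
split=> [xi eta|c xi]; first by have := linA 1 xi eta; rewrite !scale1r.
by have := linA c xi 0; rewrite !addr0 A0 addr0.
Qed.

Lemma trace_finite_add A B : trace_finite tau A -> trace_finite tau B ->
  positive_operator A /\ positive_operator B /\
  fine (tau (A + B)) = fine (tau A) + fine (tau B).
Proof.
move=> [pA fA] [pB fB]; split=> //; split=> //.
have [t0 tD _ _ _] := tau_singular.
by rewrite tD// fineD// ge0_fin_numE ?t0.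
Qed.

(* The form xi |-> (xi, T xi) determines T, and each positive operator
   contributes a real number to it: T thus determines its selfadjoint and
   antiselfadjoint parts. *)
Lemma trace_value_unique T z z' :
  trace_value tau T z -> trace_value tau T z' -> z = z'.
Proof.
move=> [A1 [A2 [B1 [B2 [[fA1 fA2 fB1 fB2] [-> ->]]]]]].
move=> [A1' [A2' [B1' [B2' [[fA1' fA2' fB1' fB2'] [eT ->]]]]]].
have [pA1 [pA2' tA]] := trace_finite_add fA1 fA2'.
have [pA1' [pA2 tA']] := trace_finite_add fA1' fA2.
have [pB1 [pB2' tB]] := trace_finite_add fB1 fB2'.
have [pB1' [pB2 tB']] := trace_finite_add fB1' fB2.
have real (A : H -> H) : positive_operator A -> forall xi, Im (inner xi (A xi)) = 0.
  by move=> [_ A0] xi; have := A0 xi; rewrite lecE /= => /andP[/eqP].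
pose X xi := A1 xi - A2 xi - A1' xi + A2' xi.
pose Y xi := B1 xi - B2 xi - B1' xi + B2' xi.
have form (P1 P2 P3 P4 : H -> H) : positive_operator P1 -> positive_operator P2 ->
    positive_operator P3 -> positive_operator P4 ->
    [/\ forall xi eta, P1 (xi + eta) - P2 (xi + eta) - P3 (xi + eta) + P4 (xi + eta)
          = (P1 xi - P2 xi - P3 xi + P4 xi) + (P1 eta - P2 eta - P3 eta + P4 eta),
        forall c xi, P1 (c *: xi) - P2 (c *: xi) - P3 (c *: xi) + P4 (c *: xi)
          = c *: (P1 xi - P2 xi - P3 xi + P4 xi) &
        forall xi, Im (inner xi (P1 xi - P2 xi - P3 xi + P4 xi)) = 0].
  move=> p1 p2 p3 p4.
  have [D1 Z1] := positive_operator_linear p1.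
  have [D2 Z2] := positive_operator_linear p2.
  have [D3 Z3] := positive_operator_linear p3.
  have [D4 Z4] := positive_operator_linear p4.
  split=> [xi eta|c xi|xi].
  - by rewrite D1 D2 D3 D4; apply: ell2P => i;
      rewrite !(ell2_addE, ell2_oppE); ring.
  - by rewrite Z1 Z2 Z3 Z4; apply: ell2P => i;
      rewrite !(ell2_addE, ell2_oppE, ell2_scaleE); ring.
  - have innerNr (u v : H) : inner u (- v) = - inner u v.
      by rewrite -scaleN1r innerZr mulN1r.
    rewrite !innerDr !innerNr.
    have ImD (x y : R[i]) : Im (x + y) = Im x + Im y by case: x y => ? ? [].
    have ImN (x : R[i]) : Im (- x) = - Im x by case: x.
    by rewrite 3!ImD 2!ImN (real P1 p1) (real P2 p2) (real P3 p3) (real P4 p4); lra.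
have [XD XZ XR] := form _ _ _ _ pA1 pA2 pA1' pA2'.
have [YD YZ YR] := form _ _ _ _ pB1 pB2 pB1' pB2'.
have XY xi : X xi + 'i%C *: Y xi = 0.
  apply: ell2P => i; have /(congr1 (fun T : H -> H => T xi i)) := eT.
  rewrite -[LHS]/((A1 xi - A2 xi + 'i%C *: (B1 xi - B2 xi)) i).
  rewrite -[RHS]/((A1' xi - A2' xi + 'i%C *: (B1' xi - B2' xi)) i).
  rewrite !(ell2_addE, ell2_oppE, ell2_scaleE) => e.
  transitivity (A1 xi i - A2 xi i + 'i%C * (B1 xi i - B2 xi i) -
    (A1' xi i - A2' xi i + 'i%C * (B1' xi i - B2' xi i))); first ring.
  by rewrite e subrr.
have form0 xi : inner xi (X xi) = 0 /\ inner xi (Y xi) = 0.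
  have : inner xi (X xi) + 'i%C * inner xi (Y xi) = 0.
    rewrite -innerZr -innerDr XY.
    by rewrite -[0 : H](scale0r 0) innerZr mul0r.
  have := XR xi; have := YR xi; rewrite -/(X xi) -/(Y xi).
  case: (inner xi (X xi)) (inner xi (Y xi)) => x x' [y y'] /= -> -> /eqP.
  rewrite eq_complex /= => /andP[/eqP h1 /eqP h2].
  have -> : x = 0 by lra.
  by have -> : y = 0 by lra.
have X0 : X = fun=> 0 by apply: eq0_of_quadratic_form => // xi; have [] := form0 xi.
have Y0 : Y = fun=> 0 by apply: eq0_of_quadratic_form => // xi; have [] := form0 xi.
(* Additivity of [tau] is available for positive operators only, so X = 0 is rearranged into an
   equality between sums of positive operators before traces are taken. *)
have eA : A1 + A2' = A1' + A2.
  apply/funext => xi; apply: ell2P => i.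
  have /(congr1 (fun T : H -> H => T xi i)) := X0.
  rewrite /X !(ell2_addE, ell2_oppE) => e; apply/eqP; rewrite -subr_eq0; apply/eqP.
  transitivity ((A1 xi + A2' xi) i - (A1' xi + A2 xi) i); first by [].
  by rewrite -[RHS]e !ell2_addE; ring.
have eB : B1 + B2' = B1' + B2.
  apply/funext => xi; apply: ell2P => i.
  have /(congr1 (fun T : H -> H => T xi i)) := Y0.
  rewrite /Y !(ell2_addE, ell2_oppE) => e; apply/eqP; rewrite -subr_eq0; apply/eqP.
  transitivity ((B1 xi + B2' xi) i - (B1' xi + B2 xi) i); first by [].
  by rewrite -[RHS]e !ell2_addE; ring.
by rewrite eA tA' in tA; rewrite eB tB' in tB; congr (_ +i* _); lra.
Qed.

Lemma trace_ext_value T z : trace_value tau T z -> trace_ext tau T = z.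
Proof.
by move=> Tz; apply: trace_value_unique (Tz); apply: xgetPex; exists z.
Qed.

Lemma trace_value_rdiag (T : H -> H) a1 a2 a3 a4 :
  bounded_weight a1 -> bounded_weight a2 -> bounded_weight a3 -> bounded_weight a4 ->
  trace_finite tau (rdiag a1) -> trace_finite tau (rdiag a2) ->
  trace_finite tau (rdiag a3) -> trace_finite tau (rdiag a4) ->
  (forall xi i, T xi i = ((a1 i - a2 i) +i* (a3 i - a4 i)) * xi i) ->
  trace_value tau T ((fine (tau (rdiag a1)) - fine (tau (rdiag a2))) +i*
                     (fine (tau (rdiag a3)) - fine (tau (rdiag a4)))).
Proof.
move=> b1 b2 b3 b4 f1 f2 f3 f4 TE.
exists (rdiag a1), (rdiag a2), (rdiag a3), (rdiag a4); split=> //; split=> //.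
apply/funext => xi; apply: ell2P => i.
transitivity (rdiag a1 xi i - rdiag a2 xi i + 'i%C * (rdiag a3 xi i - rdiag a4 xi i));
  last by [].
rewrite TE (rdiagE _ _ b1) (rdiagE _ _ b2) (rdiagE _ _ b3) (rdiagE _ _ b4).
case: (xi i) => u v; apply/eqP; rewrite eq_complex /=.
by apply/andP; split; apply/eqP; ring.
Qed.

(** The operator is diagonal with entries g w. The positive and negative parts of Re g and Im g,
    times w, give the four positive operators required by [trace_value]; each is dominated by |M| w
    and so has finite trace. *)
Lemma trace_value_multiplication (g : I -> R[i]) w (M : R) :
  (forall i, normc (g i) <= M) -> (forall i, 0 <= w i) -> bounded_weight w ->
  (tau (rdiag w) < +oo)%E ->
  let t (u : I -> R) := fine (tau (rdiag (fun i => u i * w i))) in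
  trace_value tau (multiplication g \o rdiag w)
    ((t (fun i => Num.max (Re (g i)) 0) - t (fun i => Num.max (- Re (g i)) 0)) +i*
     (t (fun i => Num.max (Im (g i)) 0) - t (fun i => Num.max (- Im (g i)) 0))).
Proof.
move=> gM w0 bw fw t.
have ReM i : `|Re (g i)| <= M.
  apply: (le_trans _ (gM i)); case: (g i) => x y /=.
  by rewrite -sqrtr_sqr ler_wsqrtr// lerDl sqr_ge0.
have ImM i : `|Im (g i)| <= M.
  apply: (le_trans _ (gM i)); case: (g i) => x y /=.
  by rewrite -sqrtr_sqr ler_wsqrtr// lerDr sqr_ge0.
have M0 (i : I) : 0 <= M by exact: le_trans (normr_ge0 _) (ReM i).
have tf (u : I -> R) : (forall i, `|u i| <= M) ->
    bounded_weight (fun i => Num.max (u i) 0 * w i) /\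
    trace_finite tau (rdiag (fun i => Num.max (u i) 0 * w i)).
  move=> uM.
  have u0 i : 0 <= Num.max (u i) 0 by rewrite le_max lexx orbT.
  have uM' i : Num.max (u i) 0 <= M.
    by rewrite ge_max (M0 i) andbT (le_trans (ler_norm _)).
  have bu : bounded_weight (fun i => Num.max (u i) 0 * w i).
    apply: bounded_weightM => //; exists M => i.
    by rewrite ger0_norm.
  split=> //; split; first by apply: rdiag_positive => // i; exact: mulr_ge0.
  apply: (@le_lt_trans _ _ (tau (rdiag (fun i => `|M| * w i)))).
    apply: trace_le => [i|]; last by apply: bounded_weightM => //; exact: bounded_weight_cst.
    rewrite mulr_ge0//= ler_wpM2r// (le_trans (uM' i))//; exact: ler_norm.
  by rewrite trace_scale// lte_mul_pinfty// lee_fin.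
have nReM i : `|- Re (g i)| <= M by rewrite normrN.
have nImM i : `|- Im (g i)| <= M by rewrite normrN.
have [b1 f1] := tf _ ReM; have [b2 f2] := tf _ nReM.
have [b3 f3] := tf _ ImM; have [b4 f4] := tf _ nImM.
apply: trace_value_rdiag => // xi i.
have bid : bijective (@id I) by exists id.
transitivity (g i * ((w i)%:C * xi i)).
  by rewrite -(rdiagE _ _ bw); exact: weighted_compositionE bid gM.
have maxN (x : R) : x = Num.max x 0 - Num.max (- x) 0.
  case: (lerP 0 x) => h.
    have h' : - x <= 0 by rewrite oppr_le0.
    by rewrite (max_idPr h') subr0.
  have h' : 0 <= - x by rewrite oppr_ge0 ltW.
  by rewrite (max_idPl h') add0r opprK.
case: (g i) (xi i) => x y [u v]; move: (maxN x) (maxN y) => /=.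
move: (Num.max x 0) (Num.max (- x) 0) (Num.max y 0) (Num.max (- y) 0).
move=> p1 p2 p3 p4 -> ->; apply/eqP; rewrite eq_complex /=.
by apply/andP; split; apply/eqP; ring.
Qed.

End SingularTrace.

(** * The powers of |D| *)

Section DeltaInvolution.
Context {R : realType} {I : choiceType}.

Lemma delta_involution (i j : I) (op : I -> I) : involutive op ->
  delta i (op j) = delta (op i) j :> R[i].
Proof. by move=> opK; rewrite !deltaE (inv_eq opK). Qed.

Lemma delta_involution2 (i j : I) (op : I -> I) : involutive op ->
  delta (op i) (op j) = delta i j :> R[i].
Proof. by move=> opK; rewrite -delta_involution// opK. Qed.

Lemma delta_eq_or0 (i j : I) : j = i \/ delta i j = 0 :> R[i].
Proof. by rewrite deltaE; case: eqP; [left|right]. Qed.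

(** Coordinate form of the diagonalization of [[0, a], [a, 0]]: the sum and the difference of the
    two basis vectors are eigenvectors for a and -a. *)
Lemma delta_involution_eigen (op : I -> I) (a : I -> R) (i j : I) :
  involutive op -> (forall k, a (op k) = a k) ->
  (a i)%:C * (delta i j + delta (op i) j) =
    (a j)%:C * (delta i (op j) + delta (op i) (op j)) :> R[i] /\
  (- a i)%:C * (delta i j - delta (op i) j) =
    (a j)%:C * (delta i (op j) - delta (op i) (op j)) :> R[i].
Proof.
move=> opK aop; rewrite (delta_involution _ _ opK) (delta_involution2 _ _ opK).
have : a i = a j \/ delta i j = 0 :> R[i] /\ delta (op i) j = 0 :> R[i].
  have [->|h] := delta_eq_or0 i j; first by left.
  have [->|h'] := delta_eq_or0 (op i) j; first by left; rewrite aop.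
  by right.
case=> [->|[-> ->]]; last by rewrite subr0 addr0 !mulr0.
split; first by rewrite addrC.
by rewrite rmorphN mulNr -mulrN opprB.
Qed.

Lemma half_sum_diff (xi eta : ell2 R I) :
  xi = (2^-1)%:C *: (xi + eta) + (2^-1)%:C *: (xi - eta).
Proof.
apply: ell2P => i; rewrite ell2_addE !ell2_scaleE !ell2_addE ell2_oppE.
case: (xi i) (eta i) => x x' [y y']; apply/eqP; rewrite eq_complex /=.
by apply/andP; split; apply/eqP; field.
Qed.

Lemma bounded_operator_half (T : ell2 R I -> ell2 R I) xi eta :
  bounded_operator T ->
  T xi = (2^-1)%:C *: T (xi + eta) + (2^-1)%:C *: T (xi - eta).
Proof.
move=> bT; rewrite {1}(half_sum_diff xi eta).
have := bounded_operator_sum (n := 2) (fun=> (2^-1)%:C)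
  (fun k => if k == ord0 then xi + eta else xi - eta) bT.
by rewrite !big_ord_recl !big_ord0 /= !addr0.
Qed.

End DeltaInvolution.

Section AbsPower.
Context {R : realType} (S : limit_system R).
Local Notation I := (boundary_index S).
Local Notation H := (ell2 R I).
Local Notation D := (dirac_operator S).
Hypothesis length_gt0 : forall i : I, 0 < interval_length i.
Variables (L s : R).
Hypotheses (length_le : forall i : I, interval_length i <= L) (s_gt0 : 0 < s).

(** The eigenvalue of |D|^-s on the summand of an interval: D has there the eigenvalues plus and
    minus the inverse length, with the same absolute value. *)
Definition weight (i : I) : R := interval_length i `^ s.

Lemma weight_gt0 i : 0 < weight i. Proof. by rewrite powR_gt0. Qed.

Lemma bounded_weight_weight : bounded_weight weight.
Proof.
exists (L `^ s) => i; rewrite (ger0_norm (ltW (weight_gt0 i))).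
have l0 := length_gt0 i.
rewrite /weight; apply: ge0_ler_powR; rewrite ?nnegrE ?(ltW s_gt0) ?(ltW l0)//.
exact: ltW (lt_le_trans l0 (length_le i)).
Qed.

(** Where xi i is nonzero, the eigenvalue equations at i and at the opposite end give mu ^ 2 = l ^
    -2 for the length l, hence |mu| ^ -s = l ^ s; where xi i = 0 both sides vanish. *)
Lemma eigenvector_weight mu (xi : H) : eigenvector D mu xi ->
  rdiag weight xi = (`|mu| `^ (- s))%:C *: xi.
Proof.
move=> ev; apply: ell2P => i; rewrite rdiagE; last exact: bounded_weight_weight.
rewrite ell2_scaleE; have [->|xi0] := eqVneq (xi i) 0; first by rewrite !mulr0.
congr (_%:C * _).
have l0 := length_gt0 i; set l := interval_length i in l0 *.
have h1 : mu%:C * xi i = (l^-1)%:C * xi (opposite_end i) by have := ev i.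
have h2 : mu%:C * xi (opposite_end i) = (l^-1)%:C * xi i.
  have := ev (opposite_end i).
  by rewrite ell2_scaleE /opposite_end /= negbK -surjective_pairing.
have : (mu ^+ 2)%:C * xi i = (l^-1 ^+ 2)%:C * xi i.
  by rewrite !rmorphXn !expr2 -!mulrA h1 mulrCA h2.
move=> /(mulIf xi0) /(congr1 (@complex.Re R)) /= mu2.
have -> : `|mu| = l^-1.
  by rewrite -sqrtr_sqr mu2 sqrtr_sqr ger0_norm// invr_ge0 ltW.
by rewrite /weight -/l powRN -powRN -powR_inv1 ?ltW// -powRrM mulN1r opprK.
Qed.

Lemma delta_eigenvectors (i : I) :
  eigenvector D (interval_length i)^-1 (delta i + delta (opposite_end i)) /\
  eigenvector D (- (interval_length i)^-1) (delta i - delta (opposite_end i)).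
Proof.
have opK : involutive (@opposite_end R S).
  by move=> [j b]; rewrite /opposite_end /= negbK.
split=> j.
  by have [] := delta_involution_eigen (a := fun k => (interval_length k)^-1) i j opK
    (fun=> erefl).
by have [] := delta_involution_eigen (a := fun k => (interval_length k)^-1) i j opK
  (fun=> erefl).
Qed.

(** The diagonal operator is a candidate, so [xget] returns a genuine function of D. It is the only
    one: each basis vector is half the sum of two eigenvectors, and a bounded operator is determined
    by its values on the basis. *)
Lemma abs_powerE : abs_power D (- s) = rdiag weight.
Proof.
have wP : is_function_of D (fun mu => `|mu| `^ (- s)) (rdiag weight).
  split; first exact/rdiag_bounded/bounded_weight_weight.
  exact: eigenvector_weight.
have [bT TE] : is_function_of D (fun mu => `|mu| `^ (- s)) (abs_power D (- s)).
  by apply: xgetPex; exists (rdiag weight).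
have [bW WE] := wP.
apply: bounded_operator_ext => // i.
have [e1 e2] := delta_eigenvectors i.
rewrite (bounded_operator_half _ (delta (opposite_end i)) bT).
rewrite (bounded_operator_half _ (delta (opposite_end i)) bW).
rewrite (TE _ _ e1) (TE _ _ e2) (WE _ _ e1) (WE _ _ e2).
by [].
Qed.

End AbsPower.

(** * Tiles and lacunae of the fractal *)

Section Affine.
Context {R : realType}.
Implicit Types (w : R -> R) (al x y : R) (A : set R).

Definition affine al w := forall x y, w x - w y = al * (x - y).

(** With u = w x - w 0 and al = w 1 - w 0, squaring the three distances between 0, 1 and x gives u ^
    2, (u - al) ^ 2 and al ^ 2; their combination is linear in u and yields u = al x. The sign of al
    records the orientation. *)
Lemma similarity_affine w (la : R) : 0 < la ->
  (forall x y, `|w x - w y| = la * `|x - y|) -> exists2 al, `|al| = la & affine al w.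
Proof.
move=> la0 simw.
pose al := w 1 - w 0.
have al_la : `|al| = la by rewrite simw subr0 normr1 mulr1.
have al0 : al != 0 by rewrite -normr_gt0 al_la.
have wE x : w x - w 0 = al * x.
  have sq u v : (w u - w v) ^+ 2 = la ^+ 2 * (u - v) ^+ 2.
    by rewrite -real_normK ?num_real// simw exprMn real_normK ?num_real.
  have := sq x 0; have := sq 1 0; have := sq x 1.
  have -> : w x - w 1 = (w x - w 0) - al by rewrite /al; ring.
  rewrite -/al; move: (w x - w 0) => u h1 h2 h3.
  apply: (mulfI al0); rewrite mulrA -expr2 h2; nra.
exists al => // x y.
have -> : w x - w y = (w x - w 0) - (w y - w 0) by ring.
by rewrite (wE x) (wE y); ring.
Qed.

Lemma affine_id : affine 1 id. Proof. by move=> x y; rewrite mul1r. Qed.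

Lemma affine_comp al be v w : affine al v -> affine be w -> affine (al * be) (v \o w).
Proof. by move=> av aw x y; rewrite /= av aw mulrA. Qed.

Lemma affine_inj al w : al != 0 -> affine al w -> injective w.
Proof.
move=> al0 aw x y /eqP; rewrite -subr_eq0 aw mulf_eq0 (negbTE al0) /= subr_eq0.
by move/eqP.
Qed.

Lemma affine_inv al w : al != 0 -> affine al w ->
  exists v, [/\ affine al^-1 v, cancel w v & cancel v w].
Proof.
move=> al0 aw; exists (fun y => (y - w 0) / al).
have wE x : w x = w 0 + al * x by have := aw x 0; rewrite subr0; lra.
split=> [x y|x|y]; first by field.
  by rewrite (wE x); field.
by rewrite wE; field.
Qed.

Lemma affine_image_itv al w x y : al != 0 -> affine al w -> x < y ->
  exists c d, [/\ c < d, d - c = `|al| * (y - x),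
    w @` `[x, y] = `[c, d]%classic, w @` `]x, y[ = `]c, d[%classic &
    (c = w x /\ d = w y) \/ (c = w y /\ d = w x)].
Proof.
move=> al0 aw xy.
have [v [av wv vw]] := affine_inv al0 aw.
case: (ltrgt0P al) al0 => // alp _.
- exists (w x), (w y).
  have sub u z : (w u <= w z) = (u <= z).
    by rewrite -subr_ge0 aw pmulr_rge0// subr_ge0.
  have subl u z : (w u < w z) = (u < z) by rewrite -subr_gt0 aw pmulr_rgt0// subr_gt0.
  split; [by rewrite subl|by rewrite aw|..|by left].
  + apply/seteqP; split=> [_ [z /= zxy <-]|z zxy].
      by move: zxy; rewrite !in_itv /= !sub.
    exists (v z) => //=; move: zxy; rewrite -{1}[z]vw /= !in_itv /=.
    by rewrite !sub.
  + apply/seteqP; split=> [_ [z /= zxy <-]|z zxy].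
      by move: zxy; rewrite !in_itv /= !subl.
    exists (v z) => //=; move: zxy; rewrite -{1}[z]vw /= !in_itv /=.
    by rewrite !subl.
- exists (w y), (w x).
  have sub u z : (w u <= w z) = (z <= u).
    by rewrite -subr_ge0 aw nmulr_rge0// subr_le0.
  have subl u z : (w u < w z) = (z < u) by rewrite -subr_gt0 aw nmulr_rgt0// subr_lt0.
  split; [by rewrite subl|by rewrite aw; ring|..|by right].
  + apply/seteqP; split=> [_ [z /= zxy <-]|z zxy].
      by move: zxy; rewrite !in_itv /= !sub andbC.
    exists (v z) => //=; move: zxy; rewrite -{1}[z]vw /= !in_itv /=.
    by rewrite !sub andbC.
  + apply/seteqP; split=> [_ [z /= zxy <-]|z zxy].
      by move: zxy; rewrite !in_itv /= !subl andbC.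
    exists (v z) => //=; move: zxy; rewrite -{1}[z]vw /= !in_itv /=.
    by rewrite !subl andbC.
Qed.

Lemma image_cancel (v w : R -> R) A B : cancel w v -> w @` A = B -> v @` B = A.
Proof.
move=> wv <-; rewrite image_comp; apply/seteqP; split=> [_ [x Ax <-]|x Ax].
  by rewrite /= wv.
by exists x => //=.
Qed.

Lemma closed_sup_mem A : A !=set0 -> has_ubound A -> closed A -> A (sup A).
Proof. by move=> A0 uA cA; apply/cA/closure_sup. Qed.

Lemma closed_inf_mem A : A !=set0 -> has_lbound A -> closed A -> A (inf A).
Proof.
move=> A0 lA cA.
have A'0 : (-%R @` A) !=set0 by case: A0 => x Ax; exists (- x), x.
have uA : has_ubound (-%R @` A).
  by case: lA => m mA; exists (- m) => _ [x Ax <-]; rewrite lerN2 mA.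
have eA : -%R @` A = -%R @^-1` A.
  apply/seteqP; split=> [_ [x Ax <-]|x Ax]; first by rewrite /= opprK.
  by exists (- x) => //; rewrite opprK.
have cA' : closed (-%R @` A).
  by rewrite eA; apply: closed_comp => // x _; exact: opp_continuous.
by have := closed_sup_mem A'0 uA cA'; rewrite {1}eA.
Qed.

End Affine.

Section Tiles.
Context {R : realType} (S : limit_system R).
Local Notation a := (lend S).
Local Notation b := (rend S).
Local Notation AB := (`[a, b]%classic : set R).
Local Notation F := (fractal S).
Implicit Types (si ta : nat -> nat) (n m : nat).

Lemma ends_lt : a < b. Proof. exact: lend_lt_rend. Qed.

Definition valid si n := forall k, (k < n)%N -> (si k < nmaps S k)%N.

Lemma valid_le si n m : (n <= m)%N -> valid si m -> valid si n.
Proof. by move=> nm v k kn; apply: v; exact: leq_trans nm. Qed.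

Lemma eq_word_map si ta n : (forall k, (k < n)%N -> si k = ta k) ->
  word_map S si n = word_map S ta n.
Proof.
elim: n => // n ih e; rewrite /= ih => [|k kn]; last by rewrite e// ltnW.
by rewrite e.
Qed.

Lemma smap_affine n i : (i < nmaps S n)%N ->
  exists2 al, `|al| = Defs.ratio S n i & affine al (smap S n i).
Proof.
move=> i_n; apply: similarity_affine; last exact: smap_similarity.
by have /andP[] := ratio_itv i_n.
Qed.

Lemma word_map_affine si n : valid si n ->
  exists2 al, `|al| = \prod_(k < n) Defs.ratio S k (si k) & affine al (word_map S si n).
Proof.
elim: n => [|n ih] v; first by exists 1; [rewrite big_ord0 normr1|exact: affine_id].
have [al al1 aw] := ih (valid_le (leqnSn n) v).
have [be be1 bw] := smap_affine (v n (ltnSn n)).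
exists (al * be); first by rewrite normrM big_ord_recr /= al1 be1.
exact: affine_comp.
Qed.

Lemma word_map_slope si n : valid si n ->
  exists al, [/\ al != 0, `|al| = \prod_(k < n) Defs.ratio S k (si k) &
    affine al (word_map S si n)].
Proof.
move=> v; have [al al1 aw] := word_map_affine v; exists al; split=> //.
rewrite -normr_gt0 al1 prodr_gt0// => k _.
by have /andP[] := ratio_itv (v k (ltn_ord k)).
Qed.

Lemma word_map_inj si n : valid si n -> injective (word_map S si n).
Proof. by move=> /word_map_slope[al [al0 _ aw]]; exact: affine_inj aw. Qed.

Lemma iter_setE n (A : set R) :
  iter_set S n A = \bigcup_(si in [set si | valid si n]) (word_map S si n @` A).
Proof.
elim: n A => [|n ih] A.
  rewrite /=; apply/seteqP; split=> [x Ax|x [si _ [y Ay <-]]] //.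
  by exists (fun=> 0%N) => //; exists x.
rewrite /= ih; apply/seteqP; split=> [x [si v [y [i i_n [z Az <-]] <-]]|].
  exists (fun k => if k == n then i else si k).
    move=> k; rewrite ltnS leq_eqVlt => /orP[/eqP ->|kn]; first by rewrite eqxx.
    by rewrite ltn_eqF//; exact: v.
  exists z => //=; rewrite eqxx; congr (_ _).
  by apply: eq_word_map => k kn; rewrite ltn_eqF.
move=> x [si v [z Az <-]]; exists si; first exact: valid_le v.
exists (smap S n (si n) z) => //; exists (si n); first exact: v.
by exists z.
Qed.

Lemma tiles_cover n x : iter_set S n AB x <-> exists2 I, tiles S n I & I x.
Proof.
rewrite iter_setE; split=> [[si v wx]|[_ [si v <-] wx]].
  by exists (word_map S si n @` AB) => //; exists si.
by exists si.
Qed.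

Lemma smap_AB n i x : (i < nmaps S n)%N -> AB x -> AB (smap S n i x).
Proof. by move=> i_n ABx; apply: (smap_stable i_n); exists x. Qed.

Lemma word_map_prefix si n m : (n <= m)%N -> valid si m ->
  word_map S si m @` AB `<=` word_map S si n @` AB.
Proof.
elim: m => [|m ih]; first by rewrite leqn0 => /eqP -> _ x.
rewrite leq_eqVlt => /orP[/eqP -> _ x //|nm] v.
apply: subset_trans (ih nm (valid_le (leqnSn m) v)).
move=> _ [x ABx <-]; exists (smap S m (si m) x) => //.
by apply: smap_AB => //; exact: v.
Qed.

Lemma iter_set_anti n m : (n <= m)%N -> iter_set S m AB `<=` iter_set S n AB.
Proof.
move=> nm x; rewrite !iter_setE => -[si v wx].
exists si; first exact: valid_le v.
exact: word_map_prefix wx.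
Qed.

(** The definition intersects the levels from 1 on; level 0 is added because the levels decrease. *)
Lemma fractalE x : F x <-> forall n, iter_set S n AB x.
Proof.
split=> [Fx n|h n _]; last exact: h.
exact: (iter_set_anti (leqnSn n)) (Fx n I).
Qed.

Lemma fractal_sub : F `<=` AB.
Proof. by move=> x /fractalE /(_ 0%N). Qed.

(** If two tiles meet, so do those of the shorter words, which agree by induction. The common prefix
    map is injective, so the common point pulls back to two images of one level, whose disjointness
    forces equal last letters. *)
Lemma word_map_disjoint si ta n : valid si n -> valid ta n ->
  (word_map S si n @` AB) `&` (word_map S ta n @` AB) !=set0 ->
  forall k, (k < n)%N -> si k = ta k.
Proof.
elim: n => // n ih vs vt [x [[y ABy wy] [z ABz wz]]].
have e : forall k, (k < n)%N -> si k = ta k.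
  apply: ih; [exact: valid_le vs|exact: valid_le vt|].
  exists x; split; first by apply: (word_map_prefix (leqnSn n) vs); exists y.
  by apply: (word_map_prefix (leqnSn n) vt); exists z.
move=> k; rewrite ltnS leq_eqVlt => /orP[/eqP ->|/e//].
apply: contrapT => ne.
have : (smap S n (si n) @` AB `&` smap S n (ta n) @` AB) (smap S n (si n) y).
  split; first by exists y.
  exists z => //.
  apply: (word_map_inj (valid_le (leqnSn n) vs)).
  by move: wz; rewrite -wy /= (eq_word_map e).
by rewrite (smap_disjoint (vs n (ltnSn n)) (vt n (ltnSn n)) ne).
Qed.

Lemma tiles_disjoint n I J : tiles S n I -> tiles S n J -> I `&` J !=set0 -> I = J.
Proof.
move=> [si vs <-] [ta vt <-] h.
by rewrite (eq_word_map (word_map_disjoint vs vt h)).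
Qed.

(** By [smap_ends], an end e is the image of an end e' under some map of level n. So the end point
    of a tile is also an end point of a tile one level deeper, and the argument repeats. *)
Lemma word_map_end_mem si n m e : valid si n -> [set a; b] e ->
  iter_set S (m + n) AB (word_map S si n e).
Proof.
elim: m si n e => [|m ih] si n e v abe.
  rewrite iter_setE; exists si => //; exists e => //.
  by case: abe => ->; rewrite /= in_itv /= lexx ltW// ends_lt.
have [i i_n [e' abe' e'e]] := @smap_ends R S n e abe.
pose ta k := if k == n then i else si k.
have vt : valid ta n.+1.
  move=> k; rewrite ltnS leq_eqVlt /ta => /orP[/eqP ->|kn]; first by rewrite eqxx.
  by rewrite ltn_eqF//; exact: v.
rewrite addSnnS; have := ih ta n.+1 e' vt abe'; rewrite /= {2}/ta eqxx e'e.
rewrite (@eq_word_map ta si)// => k kn.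
by rewrite /ta ltn_eqF.
Qed.

Lemma word_map_end si n e : valid si n -> [set a; b] e -> F (word_map S si n e).
Proof.
move=> v abe; apply/fractalE => m.
by apply: (iter_set_anti (leq_addr n m)); exact: word_map_end_mem.
Qed.

Lemma tile_itv n I : tiles S n I ->
  exists c d, [/\ c < d, I = `[c, d]%classic, F c & F d].
Proof.
move=> [si v <-]; have [al [al0 _ aw]] := word_map_slope v.
have [c [d [cd _ -> _ h]]] := affine_image_itv al0 aw ends_lt.
exists c, d; split=> //.
  by case: h => -[-> _]; apply: word_map_end => //; [left|right].
by case: h => -[_ ->]; apply: word_map_end => //; [right|left].
Qed.

Lemma tile_length n I c d : tiles S n I -> I = `[c, d]%classic -> c < d ->
  exists2 si, valid si n & d - c = (\prod_(k < n) Defs.ratio S k (si k)) * (b - a).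
Proof.
move=> [si v <-]; have [al [al0 al1 aw]] := word_map_slope v.
have [c' [d' [cd' dc' -> _ _]]] := affine_image_itv al0 aw ends_lt => e cd.
exists si => //; rewrite -al1 -dc'.
have ss : sup `[c', d']%classic = sup `[c, d]%classic by rewrite e.
have ii : inf `[c', d']%classic = inf `[c, d]%classic by rewrite e.
by move: ss ii; rewrite !sup_itvcc ?inf_itvcc ?ltW// => -> ->.
Qed.

Lemma nmaps_gt0 n : (0 < nmaps S n)%N.
Proof.
have [i i_n _] := @smap_ends R S n a (or_introl erefl).
exact: leq_ltn_trans i_n.
Qed.

Lemma tiles_nonempty n : tiles S n !=set0.
Proof.
by exists (word_map S (fun=> 0%N) n @` AB), (fun=> 0%N) => // k _; exact: nmaps_gt0.
Qed.

(** Finiteness is stated for the maps and not for the words: a word is an infinite sequence,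
    constrained only in its first n letters. *)
Lemma finite_words n :
  finite_set [set word_map S si n | si in [set si | valid si n]].
Proof.
elim: n => [|n ih].
  apply: sub_finite_set (finite_set1 (id : R -> R)) => _ [si _ <-]; exact: erefl.
apply: sub_finite_set (finite_image2
  (fun (w : R -> R) i => w \o smap S n i) ih (finite_II (nmaps S n))).
move=> _ [si v <-]; exists (word_map S si n).
  by exists si => //; exact: valid_le v.
by exists (si n); first exact: v.
Qed.

Lemma finite_tiles n : finite_set (tiles S n).
Proof.
apply: sub_finite_set (finite_image (fun w : R -> R => w @` AB) (finite_words n)).
by move=> _ [si v <-]; exists (word_map S si n) => //; exists si.
Qed.

Lemma closed_fractal : closed F.
Proof.
rewrite (_ : F = \bigcap_n iter_set S n AB); last first.
  by apply/seteqP; split=> [x /fractalE h n _ //|x h]; apply/fractalE => n; exact: h.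
apply: closed_bigI => n _.
rewrite (_ : iter_set S n AB = \bigcup_(I in tiles S n) I); last first.
  by apply/seteqP; split=> x /tiles_cover.
apply: closed_bigcup; first exact: finite_tiles.
by move=> I /tile_itv[c [d [_ -> _ _]]]; exact: itv_closed.
Qed.

Lemma fractal_tile n x : F x -> exists2 I, tiles S n I & I x.
Proof. by move=> /fractalE /(_ n) /tiles_cover. Qed.

Lemma ends_fractal : F a /\ F b.
Proof.
have v : valid (fun=> 0%N) 0 by [].
by split; apply: (word_map_end v); [left|right].
Qed.

End Tiles.

(** * Lacunae, and the summands lying in no tile of a level *)

Section Lacunae.
Context {R : realType} (S : limit_system R).
Local Notation a := (lend S).
Local Notation b := (rend S).
Local Notation AB := (`[a, b]%classic : set R).
Local Notation F := (fractal S).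

(** Two consecutive points of F. Unlike the description as a connected component, this one is
    carried over directly by an isometry that preserves parts of F. *)
Definition gap x y := [/\ F x, F y, x < y & forall z, x < z < y -> ~ F z].

Lemma gap_component x y z : gap x y -> x < z < y ->
  connected_component (AB `\` F) z = `]x, y[%classic.
Proof.
move=> [Fx Fy xy nF] /andP[xz zy].
have [ax _] : a <= x /\ x <= b by have := fractal_sub Fx; rewrite /= in_itv => /andP.
have [_ yb] : a <= y /\ y <= b by have := fractal_sub Fy; rewrite /= in_itv => /andP.
apply/seteqP; split; last first.
  apply: connected_component_max; first by rewrite /= in_itv /= xz.
    move=> t /=; rewrite in_itv /= => /andP[xt ty]; split; last by apply: nF; rewrite xt.
    by rewrite /= in_itv /= (le_trans ax (ltW xt)) (le_trans (ltW ty) yb).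
  exact/connected_intervalP/interval_is_interval.
have /connected_intervalP itv := @component_connected _ (AB `\` F) z.
have sub := @connected_component_sub _ (AB `\` F) z.
move=> t Ct.
have Cz : connected_component (AB `\` F) z z.
  apply: connected_component_refl; split; last by apply: nF; rewrite xz.
  by rewrite /= in_itv /= (le_trans ax (ltW xz)) (le_trans (ltW zy) yb).
rewrite /= in_itv /=; apply/andP; split; rewrite ltNge; apply/negP => h.
  by have [_] := sub _ (itv _ _ Ct Cz x (introT andP (conj h (ltW xz)))); apply.
by have [_] := sub _ (itv _ _ Cz Ct y (introT andP (conj (ltW zy) h))); apply.
Qed.

(** The ends of the component of z are the last point of F before z and the first one after z. They
    exist because a and b are in F and F is closed, and they differ from z because z is not in F. *)
Lemma lacunaeP (J : set R) :
  lacunae S J <-> exists x y, gap x y /\ J = `]x, y[%classic.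
Proof.
have [Fa Fb] := ends_fractal S.
have cF := @closed_fractal R S.
split=> [[z [ABz nFz] <-]|[x [y [g ->]]]]; last first.
  have [Fx Fy xy nF] := g.
  have mid : x < (x + y) / 2 < y by apply/andP; split; lra.
  exists ((x + y) / 2); last exact: gap_component mid.
  split; last exact: nF.
  have /= := fractal_sub Fx; have /= := fractal_sub Fy.
  by move: mid; rewrite !in_itv /= => /andP[? ?] /andP[? ?] /andP[? ?]; apply/andP; split; lra.
have /andP[az zb] : a <= z <= b by move: ABz; rewrite /= in_itv.
pose L := F `&` `]-oo, z]; pose U := F `&` `[z, +oo[.
have cL : closed L by apply: closedI => //; exact: interval_closed.
have cU : closed U by apply: closedI => //; exact: interval_closed.
have L0 : L !=set0 by exists a; split => //=; rewrite in_itv.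
have U0 : U !=set0 by exists b; split => //=; rewrite in_itv /= zb.
have uL : ubound L z by move=> t [_ /=]; rewrite in_itv.
have lU : lbound U z by move=> t [_ /=]; rewrite in_itv /= andbT.
have hL : has_ubound L by exists z.
have hU : has_lbound U by exists z.
have [Fx xz] := closed_sup_mem L0 hL cL.
have [Fy zy] := closed_inf_mem U0 hU cU.
rewrite /= in_itv /= in xz; rewrite /= in_itv /= andbT in zy.
have {}xz : sup L < z by rewrite lt_neqAle xz andbT; apply/eqP => e; rewrite -e in nFz.
have {}zy : z < inf U by rewrite lt_neqAle zy andbT; apply/eqP => e; rewrite e in nFz.
have g : gap (sup L) (inf U).
  split=> // [|t /andP[xt ty] Ft]; first exact: lt_trans zy.
  have [tz|zt] := leP t z.
    have Lt : L t by split => //=; rewrite in_itv.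
    by have := ub_le_sup hL Lt; rewrite leNgt xt.
  have Ut : U t by split => //=; rewrite in_itv /= andbT ltW.
  by have := ge_inf hU Ut; rewrite leNgt ty.
exists (sup L), (inf U); split=> //.
by apply: (gap_component g); rewrite xz.
Qed.

Lemma sup_inf_itv x y (J : set R) : x < y ->
  J = `[x, y]%classic \/ J = `]x, y[%classic -> sup J = y /\ inf J = x.
Proof.
move=> xy [->|->]; first by rewrite sup_itvcc ?inf_itvcc ?ltW.
by rewrite sup_itv ?inf_itv// bnd_simp.
Qed.

Lemma summand_itv u : summands S u -> exists x y, [/\ x < y, F x, F y &
  interval_of u = `[x, y]%classic \/ interval_of u = `]x, y[%classic].
Proof.
case: u => [J /lacunaeP[x [y [[Fx Fy xy _] ->]]]|[m J] /tile_itv[x [y [xy -> Fx Fy]]]].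
  by exists x, y; split=> //; right.
by exists x, y; split=> //; left.
Qed.

Lemma interval_length_gt0 (i : boundary_index S) : 0 < interval_length i.
Proof.
have [x [y [xy _ _ e]]] := summand_itv (set_mem (valP i.1)).
by rewrite /interval_length; have [-> ->] := sup_inf_itv xy e; rewrite subr_gt0.
Qed.

Lemma boundary_point_fractal (i : boundary_index S) : F (boundary_point i).
Proof.
have [x [y [xy Fx Fy e]]] := summand_itv (set_mem (valP i.1)).
by rewrite /boundary_point; have [-> ->] := sup_inf_itv xy e; case: ifP.
Qed.

Lemma interval_length_le (i : boundary_index S) : interval_length i <= b - a.
Proof.
have [x [y [xy Fx Fy e]]] := summand_itv (set_mem (valP i.1)).
rewrite /interval_length; have [-> ->] := sup_inf_itv xy e.
have := fractal_sub Fx; have := fractal_sub Fy.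
by rewrite /= !in_itv /= => /andP[? ?] /andP[? ?]; lra.
Qed.

(** The bound [n <= m] matches the last clause of [tile_map n], which transports the tiles of level
    at least n only. *)
Definition in_tile n (I : set R) (u : set R + nat * set R) : Prop :=
  match u with inl J => J `<=` I | inr (m, J) => (n <= m)%N /\ J `<=` I end.

Lemma in_tile_sub n I u : in_tile n I u -> interval_of u `<=` I.
Proof. by case: u => [J|[m J] []]. Qed.

Lemma in_tile_unique n I I' u : tiles S n I -> tiles S n I' -> summands S u ->
  in_tile n I u -> in_tile n I' u -> I = I'.
Proof.
move=> tI tI' su /in_tile_sub uI /in_tile_sub uI'.
apply: tiles_disjoint tI tI' _.
have [x [y [xy _ _ e]]] := summand_itv su.
exists ((x + y) / 2); split; [apply: uI|apply: uI'];
  by case: e => -> /=; rewrite in_itv /=; apply/andP; split; lra.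
Qed.

Lemma itv_sub_ends x y c d (J : set R) : x < y ->
  J = `[x, y]%classic \/ J = `]x, y[%classic -> J `<=` `[c, d] -> c <= x /\ y <= d.
Proof.
move=> xy eJ Jcd.
have sub z : x < z < y -> c <= z <= d.
  move=> /andP[xz zy]; suff : J z by move=> /Jcd; rewrite /= in_itv.
  by case: eJ => -> /=; rewrite in_itv /= ?xz ?zy ?(ltW xz) ?(ltW zy).
split; rewrite leNgt; apply/negP => h.
  have [cy|yc] := ltP c y.
    have : c <= (x + c) / 2 <= d by apply: sub; apply/andP; split; lra.
    by move=> /andP[? _]; lra.
  have : c <= (x + y) / 2 <= d by apply: sub; apply/andP; split; lra.
  by move=> /andP[? _]; lra.
have [xd|dx] := ltP x d.
  have : c <= (d + y) / 2 <= d by apply: sub; apply/andP; split; lra.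
  by move=> /andP[_ ?]; lra.
have : c <= (x + y) / 2 <= d by apply: sub; apply/andP; split; lra.
by move=> /andP[_ ?]; lra.
Qed.

Lemma in_tile_boundary_point n I (i : boundary_index S) : tiles S n I ->
  in_tile n I (val i.1) -> I (boundary_point i).
Proof.
move=> /tile_itv[c [d [cd -> _ _]]] /in_tile_sub sub.
have [x [y [xy _ _ e]]] := summand_itv (set_mem (valP i.1)).
have [cx yd] := itv_sub_ends xy e sub.
rewrite /boundary_point; have [-> ->] := sup_inf_itv xy e.
by case: ifP => _; rewrite /= in_itv /=; apply/andP; split; lra.
Qed.

Lemma tile_nested n m I K : (n <= m)%N -> tiles S n I -> tiles S m K ->
  I `&` K !=set0 -> K `<=` I.
Proof.
move=> nm tI [si v <-] [x [Ix Kx]].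
have sub := word_map_prefix nm v.
suff <- : word_map S si n @` AB = I by [].
apply: tiles_disjoint tI _; first by exists si => //; exact: valid_le v.
by exists x; split=> //; exact: sub.
Qed.

Definition stray n (u : set R + nat * set R) :=
  summands S u /\ forall I, tiles S n I -> ~ in_tile n I u.

(** Let [c, d] be the tile of level n containing x. If x < d, then d, a point of F, is not in ]x,
    y[, hence lies at or beyond y, and the gap would be inside the tile. *)
Lemma stray_gap n x y : gap x y -> stray n (inl `]x, y[%classic) ->
  exists2 I, tiles S n I & sup I = x.
Proof.
move=> [Fx Fy xy nF] [_ st].
have [I tI Ix] := fractal_tile n Fx; exists I => //.
have [c [d [cd Icd Fc Fd]]] := tile_itv tI.
rewrite Icd sup_itvcc ?ltW//; move: Ix; rewrite Icd /= in_itv /= => /andP[cx xd].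
apply/eqP; rewrite eq_le xd andbT leNgt; apply/negP => {}xd.
apply: (st _ tI) => /= z; rewrite Icd /= !in_itv /= => /andP[xz zy].
rewrite (le_trans cx (ltW xz)) /=; rewrite leNgt; apply/negP => dz.
by apply: (nF d) => //; rewrite xd /= (lt_trans dz).
Qed.

(** A gap is determined by its left end, so the stray gaps are no more numerous than the right ends
    of tiles. *)
Lemma gap_end x y : gap x y -> y = inf (F `&` `]x, +oo[).
Proof.
move=> [Fx Fy xy nF].
have Uy : (F `&` `]x, +oo[) y by split => //=; rewrite in_itv /= xy.
have lby : lbound (F `&` `]x, +oo[) y.
  move=> z [Fz /=]; rewrite in_itv /= andbT => xz; rewrite leNgt; apply/negP => zy.
  by apply: (nF z) => //; rewrite xz.
apply/eqP; rewrite eq_le ge_inf ?andbT//; last by exists y.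
by apply: lb_le_inf => //; exists y.
Qed.

(** [A] collects the possible stray lacunae, [B] the tiles of level below n. A tile of level at
    least n is never stray: its left end is in F, hence in some tile of level n, and nesting puts
    the whole tile there. *)
Lemma finite_stray n : finite_set (stray n).
Proof.
pose A := (fun x => inl `]x, inf (F `&` `]x, +oo[)[%classic : set R + nat * set R) @`
  (sup @` tiles S n).
pose B := \bigcup_(m in `I_n) (fun I => inr (m, I) : set R + nat * set R) @` tiles S m.
apply: (@sub_finite_set _ _ (A `|` B)); last first.
  rewrite finite_setU; split; first exact/finite_image/finite_image/finite_tiles.
  apply: bigcup_finite; first exact: finite_II.
  by move=> m _; exact/finite_image/finite_tiles.
move=> [J|[m J]] st; [left|right].
  have [/lacunaeP[x [y [g eJ]]] _] := st; rewrite eJ in st *.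
  have [K tK Kx] := stray_gap g st.
  rewrite (gap_end g); exists x; last by [].
  by exists K.
have [/= tJ h] := st.
exists m; last by exists J.
rewrite /= ltnNge; apply/negP => nm.
have [c [d [cd Jcd Fc _]]] := tile_itv tJ.
have [I0 tI Ic] := fractal_tile n Fc.
apply: (h I0 tI); split=> //; apply: (tile_nested nm tI tJ).
by exists c; split=> //; rewrite Jcd /= in_itv /= lexx ltW.
Qed.

End Lacunae.

(** * Isometries between tiles *)

Section TileMaps.
Context {R : realType} (S : limit_system R).
Hypothesis Stranslation : translation_system S.
Local Notation a := (lend S).
Local Notation b := (rend S).
Local Notation AB := (`[a, b]%classic : set R).
Local Notation F := (fractal S).

(** The last clause, on all finer tiles inside I, encodes the compatibility with the fractal:
    membership in F is tested on tiles of arbitrarily high level. *)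
Definition tile_map n (I J : set R) (p : R -> R) :=
  [/\ exists2 al, `|al| = 1 & affine al p, p @` I = J &
      forall m K, (n <= m)%N -> tiles S m K -> K `<=` I -> tiles S m (p @` K)].

(** Here v inverts the first word map. The slope has absolute value 1 because a product of ratios
    depends on the level only, and a finer tile inside the first one has a word starting with si,
    whose first n letters the map replaces by those of ta. *)
Lemma tile_map_compose n si ta v : valid S si n -> valid S ta n ->
  (forall al, al != 0 -> affine al (word_map S si n) -> affine al^-1 v) ->
  cancel (word_map S si n) v ->
  tile_map n (word_map S si n @` AB) (word_map S ta n @` AB) (word_map S ta n \o v).
Proof.
move=> vs vt av wv.
have [al [al0 al1 aw]] := word_map_slope vs.
have [be [be0 be1 bw]] := word_map_slope vt.
have albe : `|al| = `|be|.
  rewrite al1 be1; apply: eq_bigr => k _.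
  by apply: Stranslation; [exact: vs|exact: vt].
split.
- exists (be * al^-1).
    by rewrite normrM normrV ?unitfE// albe divff// normr_eq0.
  by apply: affine_comp bw _; exact: av aw.
- rewrite image_comp; apply/seteqP; split=> [_ [x ABx <-]|_ [x ABx <-]].
    by exists x => //=; rewrite wv.
  by exists x => //=; rewrite wv.
move=> m _ nm [rho vr <-] sub.
have e k : (k < n)%N -> rho k = si k.
  move: k; apply: (word_map_disjoint (valid_le nm vr) vs).
  have Aa : AB a by rewrite /= in_itv /= lexx ltW// ends_lt.
  exists (word_map S rho m a); split; last by apply: sub; exists a.
  by apply: (word_map_prefix nm vr); exists a.
pose rho' k := if (k < n)%N then ta k else rho k.
have vr' : valid S rho' m.
  move=> k km; rewrite /rho'; case: ifP => kn; first exact: vt.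
  exact: vr.
exists rho' => //.
have h x : word_map S ta n (v (word_map S rho m x)) = word_map S rho' m x.
  elim: m nm {vr sub vr'} x => [|m ih].
    rewrite leqn0 => /eqP n0 x; rewrite /=; move: wv; rewrite n0 /= => wv.
    by rewrite wv.
  rewrite leq_eqVlt => /orP[/eqP nm|nm] x.
    rewrite -nm (eq_word_map S e) wv (@eq_word_map _ S rho' ta)// => k kn.
    by rewrite /rho' kn.
  rewrite /= ih//; congr (word_map _ _ _ (smap _ _ _ _)).
  by rewrite /rho' ltnNge -ltnS nm.
by rewrite image_comp; apply/seteqP; split=> _ [x ABx <-]; exists x; rewrite //= h.
Qed.

Lemma tile_map_exists n I J : tiles S n I -> tiles S n J ->
  exists p q, [/\ tile_map n I J p, tile_map n J I q, cancel p q & cancel q p].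
Proof.
move=> [si vs <-] [ta vt <-].
have inverse (rho : nat -> nat) : valid S rho n -> exists v,
    [/\ forall al, al != 0 -> affine al (word_map S rho n) -> affine al^-1 v,
        cancel (word_map S rho n) v & cancel v (word_map S rho n)].
  move=> vr; have [al [al0 _ aw]] := word_map_slope vr.
  have [v [av wv vw]] := affine_inv al0 aw; exists v; split=> // be be0 bw x y.
  by rewrite -{2}(vw x) -{2}(vw y) bw mulKf.
have [v [av wv vw]] := inverse _ vs; have [u [au wu uw]] := inverse _ vt.
exists (word_map S ta n \o v), (word_map S si n \o u).
split; [exact: tile_map_compose|exact: tile_map_compose|..] => x /=.
  by rewrite wu vw.
by rewrite wv uw.
Qed.

Section Transport.
Variables (n : nat) (I J : set R) (p q : R -> R).
Hypotheses (tI : tiles S n I) (tJ : tiles S n J) (pIJ : tile_map n I J p)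
  (qJI : tile_map n J I q) (pq : cancel p q) (qp : cancel q p).

Lemma tile_map_fractal x : F x -> I x -> F (p x) /\ J (p x).
Proof.
have [_ pI pt] := pIJ => Fx Ix; split; last by rewrite -pI; exists x.
(* Level m is tested at level max(m, n), since the isometry is known to preserve tiles only from
   level n on. *)
apply/fractalE => m; apply: (iter_set_anti (leq_maxl m n)).
have [K tK Kx] := fractal_tile (maxn m n) Fx.
apply/tiles_cover; exists (p @` K); last by exists x.
apply: (pt _ _ (leq_maxr m n) tK).
by apply: (tile_nested (leq_maxr m n) tI tK); exists x.
Qed.

Definition summand_map (r : R -> R) (u : set R + nat * set R) : set R + nat * set R :=
  match u with inl K => inl (r @` K) | inr (m, K) => inr (m, r @` K) end.

Lemma interval_of_summand_map r u :
  interval_of (summand_map r u) = r @` interval_of u.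
Proof. by case: u => [//|[]]. Qed.

Lemma summand_map_cancel u : summand_map q (summand_map p u) = u.
Proof.
have e (K : set R) : q @` (p @` K) = K by exact: image_cancel (pq) erefl.
by case: u => [K|[m K]]; rewrite /= e.
Qed.

Lemma length_summand_map u : summands S u ->
  sup (interval_of (summand_map p u)) - inf (interval_of (summand_map p u)) =
  sup (interval_of u) - inf (interval_of u).
Proof.
move=> /summand_itv[x [y [xy _ _ e]]]; have [[al al1 ap] _ _] := pIJ.
have al0 : al != 0 by rewrite -normr_gt0 al1.
have [c [d [cd dc ecc eoo _]]] := affine_image_itv al0 ap xy.
rewrite interval_of_summand_map; have [-> ->] := sup_inf_itv xy e.
have e' : p @` interval_of u = `[c, d]%classic \/ p @` interval_of u = `]c, d[%classic.
  by case: e => ->; [left|right].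
by have [-> ->] := sup_inf_itv cd e'; rewrite dc al1 mul1r.
Qed.

End Transport.

(** For a tile this is part of [tile_map]. For a lacuna, the ends of the image are in F, and a point
    of F inside the image would be sent by q to a point of F inside the original gap. *)
Lemma summand_map_in n I J p q u : tiles S n I -> tiles S n J ->
  tile_map n I J p -> tile_map n J I q -> cancel p q -> cancel q p ->
  summands S u -> in_tile n I u ->
  summands S (summand_map p u) /\ in_tile n J (summand_map p u).
Proof.
move=> tI tJ pIJ qJI pq qp; have [[al al1 ap] pI pt] := pIJ.
case: u => [K|[m K]] /=; last first.
  move=> tK [nm KI]; split; first exact: pt.
  by split=> //; rewrite -pI; exact: image_subset.
move=> /lacunaeP[x [y [g eK]]] KI; split; last by rewrite -pI; exact: image_subset.
have [Fx Fy xy nF] := g.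
have al0 : al != 0 by rewrite -normr_gt0 al1.
have [Ix Iy] : I x /\ I y.
  have [c [d [cd eI _ _]]] := tile_itv tI; rewrite eI in KI.
  have [cx yd] := itv_sub_ends xy (or_intror eK) KI.
  by rewrite eI /= !in_itv /=; split; apply/andP; split; lra.
have [Fpx Jpx] := tile_map_fractal tI pIJ Fx Ix.
have [Fpy Jpy] := tile_map_fractal tI pIJ Fy Iy.
have [c [d [cd _ _ eoo h]]] := affine_image_itv al0 ap xy.
apply/lacunaeP; exists c, d; split; last by rewrite eK.
split=> //; [by case: h => -[-> _]|by case: h => -[_ ->]|].
move=> z zcd Fz; have : (p @` `]x, y[) z by rewrite eoo /= in_itv.
move=> [t txy ptz].
have Jz : J z by rewrite -pI -ptz; exists t => //; apply: KI; rewrite eK.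
have [Fqz _] := tile_map_fractal tJ qJI Fz Jz.
apply: (nF t); first by move: txy; rewrite /= in_itv.
by rewrite -(pq t) ptz.
Qed.

Definition swap_summand n (I J : set R) (p q : R -> R) u :=
  if `[< in_tile n I u >] then summand_map p u
  else if `[< in_tile n J u >] then summand_map q u else u.

Section Swap.
Variables (n : nat) (I J : set R) (p q : R -> R).
Hypotheses (tI : tiles S n I) (tJ : tiles S n J) (IJ : I <> J)
  (pIJ : tile_map n I J p) (qJI : tile_map n J I q)
  (pq : cancel p q) (qp : cancel q p).
Local Notation swap := (swap_summand n I J p q).

(** Since I and J are distinct, no summand lies in both; after one swap the other branch of the
    definition therefore applies, and p and q cancel. *)
Lemma swap_summandP u : summands S u ->
  [/\ summands S (swap u), swap (swap u) = u,
      in_tile n I (swap u) <-> in_tile n J u &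
      sup (interval_of (swap u)) - inf (interval_of (swap u)) =
        sup (interval_of u) - inf (interval_of u)].
Proof.
have swI v : in_tile n I v -> swap v = summand_map p v.
  by move=> vI; rewrite /swap_summand asboolT.
have swJ v : ~ in_tile n I v -> in_tile n J v -> swap v = summand_map q v.
  by move=> vI vJ; rewrite /swap_summand asboolF// asboolT.
have excl v : summands S v -> in_tile n I v -> ~ in_tile n J v.
  by move=> sv uI uJ; apply: IJ; exact: (in_tile_unique tI tJ sv uI uJ).
move=> su; have [uI|uI] := pselect (in_tile n I u).
  have [sp pJ] := summand_map_in tI tJ pIJ qJI pq qp su uI.
  have npI : ~ in_tile n I (summand_map p u) by move=> /excl; apply.
  rewrite (swI _ uI) (swJ _ npI pJ) (summand_map_cancel pq).
  split=> //; last exact: length_summand_map pIJ _ su.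
  by split=> // /(excl _ su uI).
have [uJ|uJ] := pselect (in_tile n J u); last first.
  have e : swap u = u by rewrite /swap_summand !asboolF.
  rewrite !e.
  by split=> //; split.
have [sq qI] := summand_map_in tJ tI qJI pIJ qp pq su uJ.
rewrite (swJ _ uI uJ) (swI _ qI) (summand_map_cancel qp).
by split=> //; exact: length_summand_map qJI _ su.
Qed.

End Swap.

(* The involution exchanges the summands inside I with those inside J. *)
Lemma swap_index n I J : tiles S n I -> tiles S n J -> I <> J ->
  exists e : boundary_index S -> boundary_index S, [/\ involutive e,
    forall i, interval_length (e i) = interval_length i &
    forall i, in_tile n I (val (e i).1) <-> in_tile n J (val i.1)].
Proof.
move=> tI tJ IJ; have [p [q [pIJ qJI pq qp]]] := tile_map_exists tI tJ.
have sP := swap_summandP tI tJ IJ pIJ qJI pq qp.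
have sw (u : set_type (summands S)) : swap_summand n I J p q (val u) \in summands S.
  by have [/mem_set] := sP _ (set_mem (valP u)).
exists (fun i => (SigSub (sw i.1), i.2)); split=> [[u t]|[u t]|[u t]] /=.
- congr pair; apply: val_inj => /=.
  by have [_ -> _ _] := sP _ (set_mem (valP u)).
- by rewrite /interval_length /=; have [_ _ _ ->] := sP _ (set_mem (valP u)).
- by have [_ _ + _] := sP _ (set_mem (valP u)).
Qed.

End TileMaps.

(** * The Hausdorff measure *)

Section HausdorffOuterMeasure.
Context {R : realType}.
Implicit Types (h : R -> R) (A B U X : set R) (d e : R).
Local Open Scope ereal_scope.

Lemma diam_ge0 A : 0 <= diam A.
Proof. by apply: ereal_sup_ubound; left. Qed.

Lemma diam_le A d : (0 <= d)%R -> (forall x y, A x -> A y -> `|x - y|%R <= d)%R ->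
  diam A <= d%:E.
Proof.
move=> d0 Ad; apply: ge_ereal_sup => _ [->|[x Ax] [y Ay] <-]; first by rewrite lee_fin.
by rewrite lee_fin Ad.
Qed.

Lemma le_diam_dist A d x y : diam A <= d%:E -> A x -> A y -> (`|x - y| <= d)%R.
Proof.
move=> Ad Ax Ay; rewrite -lee_fin; apply: le_trans Ad.
by apply: ereal_sup_ubound; right; exists x => //; exists y.
Qed.

Lemma diam_set0 : diam (set0 : set R) = 0.
Proof. by apply/eqP; rewrite eq_le diam_ge0 andbT; apply: diam_le. Qed.

Lemma diam_isometry (p : R -> R) A :
  (forall x y, `|p x - p y| = `|x - y|)%R -> diam (p @` A) = diam A.
Proof.
move=> pd; rewrite /diam; congr (ereal_sup (_ `|` _)).
apply/seteqP; split=> [_ [_ [x Ax <-]] [_ [y Ay <-]] <-|_ [x Ax] [y Ay] <-].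
  by exists x => //; exists y => //; rewrite pd.
by exists (p x); [exists x|exists (p y); [exists y|rewrite pd]].
Qed.

Lemma hausdorff_pre_anti h d e A : (d <= e)%R ->
  hausdorff_pre h e A <= hausdorff_pre h d A.
Proof.
move=> de; apply: ereal_inf_le_tmp => _ [U [AU Ud] <-]; exists U => //; split=> // i.
by rewrite (le_trans (Ud i))// lee_fin.
Qed.

Lemma hausdorffE h A :
  hausdorff h A = ereal_sup [set hausdorff_pre h d A | d in [set d | 0 < d]%R].
Proof.
rewrite /hausdorff; apply: cvg_lim => //.
rewrite (_ : [set d | 0 < d]%R = [set` Interval (BRight 0%R) +oo%O]); last first.
  by apply/seteqP; split=> x /=; rewrite in_itv /= andbT.
apply: nonincreasing_at_right_cvge => // d e _ _; exact: hausdorff_pre_anti.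
Qed.

Lemma hausdorff_pre_isometry h d (p : R -> R) A :
  (forall x y, `|p x - p y| = `|x - y|)%R ->
  hausdorff_pre h d (p @` A) <= hausdorff_pre h d A.
Proof.
move=> pd; apply: le_ereal_inf_tmp => _ [U [AU Ud] <-].
apply: ereal_inf_lbound; exists (fun i => p @` U i).
  split=> [_ [x /AU[i _ Ux] <-]|i]; first by exists i => //; exists x.
  by rewrite diam_isometry.
by apply: eq_eseriesr => i _; rewrite diam_isometry.
Qed.

Lemma hausdorff_isometry h (p : R -> R) A :
  (forall x y, `|p x - p y| = `|x - y|)%R ->
  hausdorff h (p @` A) <= hausdorff h A.
Proof.
move=> pd; rewrite !hausdorffE; apply: ge_ereal_sup => _ [d d0 <-].
apply: le_trans (hausdorff_pre_isometry _ _ _ pd) _.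
by apply: ereal_sup_ubound; exists d.
Qed.

Section Gauge.
Variables (h : R -> R) (hg : gauge h).

(** The value +oo turns the constraint on diameters into a cost, so that the infimum ranges over all
    coverings as in [mu_ext]. *)
Definition diam_cost d U : \bar R :=
  if diam U <= d%:E then (h (fine (diam U)))%:E else +oo.

Lemma diam_cost_ge0 d U : 0 <= diam_cost d U.
Proof.
have [_ h0 _ _] := hg; rewrite /diam_cost; case: ifP => // _.
by rewrite lee_fin h0// fine_ge0// diam_ge0.
Qed.

(* All subsets of the line are measurable for this measurable structure: the
   library outer measure [mu_ext] is then an infimum over arbitrary covers. *)
Definition discrete_line := g_sigma_algebraType [set: set R].

Lemma hausdorff_preE d A :
  hausdorff_pre h d A = @mu_ext _ discrete_line R (diam_cost d) A.
Proof.
apply/eqP; rewrite eq_le; apply/andP; split; last first.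
  apply: ereal_inf_le_tmp => _ [U [AU Ud] <-]; exists U.
    by split=> // i; exact: sub_sigma_algebra.
  by apply: eq_eseriesr => i _; rewrite /diam_cost Ud.
apply: le_ereal_inf_tmp => _ [U [_ AU] <-].
have [Ud|/existsNP[i /negP Ui]] := pselect (forall i, diam (U i) <= d%:E).
  apply: ereal_inf_lbound; exists U => //.
  by apply: eq_eseriesr => i _; rewrite /diam_cost Ud.
rewrite (@eseries_pinfty _ _ _ i) ?leey// => [n _|].
  by rewrite -ltNye (lt_le_trans _ (diam_cost_ge0 d (U n))).
by rewrite /diam_cost (negbTE Ui).
Qed.

Lemma diam_cost_set0 d : (0 <= d)%R -> diam_cost d set0 = 0.
Proof. by move=> d0; have [h0 _ _ _] := hg; rewrite /diam_cost diam_set0 lee_fin d0 /= h0. Qed.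

Lemma hausdorff_pre_ge0 d A : 0 <= hausdorff_pre h d A.
Proof. by rewrite hausdorff_preE; exact: (@mu_ext_ge0 _ discrete_line R (diam_cost d) (diam_cost_ge0 d)). Qed.

Lemma hausdorff_pre_set0 d : (0 <= d)%R -> hausdorff_pre h d set0 = 0.
Proof.
move=> d0; rewrite hausdorff_preE; exact: (@mu_ext0 _ discrete_line R (diam_cost d) (diam_cost_set0 d0) (diam_cost_ge0 d)).
Qed.

Lemma le_hausdorff_pre d A B : A `<=` B -> hausdorff_pre h d A <= hausdorff_pre h d B.
Proof.
move=> AB; rewrite !hausdorff_preE.
exact: (@le_mu_ext _ discrete_line R (diam_cost d) A B AB).
Qed.

Lemma hausdorff_pre_sigma_subadditive d : sigma_subadditive (hausdorff_pre h d).
Proof.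
rewrite (_ : hausdorff_pre h d = @mu_ext _ discrete_line R (diam_cost d)); last first.
  by apply/funext => A; exact: hausdorff_preE.
exact: (@mu_ext_sigma_subadditive _ discrete_line R (diam_cost d) (diam_cost_ge0 d)).
Qed.

Lemma hausdorff_pre_single d U : (0 <= d)%R -> diam U <= d%:E ->
  hausdorff_pre h d U <= (h (fine (diam U)))%:E.
Proof.
have [h0 hge0 _ _] := hg; move=> d0 Ud; apply: ereal_inf_lbound.
exists (fun i => if i == 0%N then U else set0).
  split=> [x Ux|[|i]] //=; first by exists 0%N.
  by rewrite diam_set0 lee_fin.
rewrite nneseries_recl => [|k _|//]; last first.
  by rewrite lee_fin hge0// fine_ge0// diam_ge0.
by rewrite eseries0 ?adde0// => -[|i] //= _ _; rewrite diam_set0 h0.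
Qed.

Lemma hausdorff_set0 : hausdorff h set0 = 0.
Proof.
rewrite hausdorffE; apply/eqP; rewrite eq_le; apply/andP; split.
  by apply: ge_ereal_sup => _ [d d0 <-]; rewrite hausdorff_pre_set0// ltW.
by apply: ereal_sup_ubound; exists 1%R => //=; rewrite hausdorff_pre_set0.
Qed.

Lemma hausdorff_ge0 A : 0 <= hausdorff h A.
Proof.
rewrite hausdorffE; apply: (@le_trans _ _ (hausdorff_pre h 1 A)).
  exact: hausdorff_pre_ge0.
by apply: ereal_sup_ubound; exists 1%R => //=.
Qed.

Lemma hausdorff_pre_le d A : (0 < d)%R -> hausdorff_pre h d A <= hausdorff h A.
Proof. by move=> d0; rewrite hausdorffE; apply: ereal_sup_ubound; exists d. Qed.

Lemma le_hausdorff : {homo hausdorff h : A B / A `<=` B >-> A <= B}.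
Proof.
move=> A B AB; rewrite [leLHS]hausdorffE; apply: ge_ereal_sup => _ [d d0 <-].
by apply: le_trans (hausdorff_pre_le _ d0); exact: le_hausdorff_pre.
Qed.

Lemma hausdorff_sigma_subadditive : sigma_subadditive (hausdorff h).
Proof.
move=> A; rewrite [leLHS]hausdorffE; apply: ge_ereal_sup => _ [d d0 <-].
apply: le_trans (hausdorff_pre_sigma_subadditive _ _) _.
apply: lee_nneseries => [i _ _|i _]; first exact: hausdorff_pre_ge0.
exact: hausdorff_pre_le.
Qed.

End Gauge.

(** The proof that h is a gauge is an argument of this alias so that the outer measure structure can
    be attached to it. *)
Definition hausdorff_outer h (hg : gauge h) : set R -> \bar R := hausdorff h.

HB.instance Definition _ h (hg : gauge h) := isOuterMeasure.Build R R
  (hausdorff_outer hg) (hausdorff_set0 hg) (hausdorff_ge0 hg) (le_hausdorff hg)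
  (hausdorff_sigma_subadditive hg).

End HausdorffOuterMeasure.

(** * Borel sets are Caratheodory measurable for the Hausdorff outer measure *)

Section HausdorffMeasure.
Context {R : realType}.
Variables (h : R -> R) (hg : gauge h).
Implicit Types (A B U X : set R) (c d e : R).
Local Open Scope ereal_scope.

(* A covering set which straddles [c] lies in [c - d, c + d]: all of them can be
   replaced by the two intervals [c - d, c] and [c, c + d], whose total cost 2 h(d)
   vanishes with d. *)
Lemma hausdorff_pre_split c d X : (0 <= d)%R ->
  hausdorff_pre h d (X `&` `]c, +oo[) + hausdorff_pre h d (X `&` ~` `]c, +oo[) <=
  hausdorff_pre h d X + (2 * h d)%:E.
Proof.
move=> d0; have [h0 hge0 hmono _] := hg.
have hd0 := hge0 _ d0.
rewrite -leeBlDr//; apply: le_ereal_inf_tmp => _ [U [XU Ud] <-].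
rewrite leeBlDr//.
pose P := `]c, +oo[%classic.
have h_ge0 A : (0 <= h (fine (diam A)))%R by rewrite hge0// fine_ge0// diam_ge0.
(* The part of X in Q is covered by the U i contained in Q, together with V, which absorbs the parts
   in Q of all the other ones. *)
have side (Q V : set R) : diam V <= d%:E ->
    (forall i, ~ (U i `<=` Q) -> U i `&` Q `<=` V) ->
    hausdorff_pre h d (X `&` Q) <= (h d)%:E +
      \sum_(0 <= i <oo) (if `[< U i `<=` Q >] then (h (fine (diam (U i))))%:E else 0).
  move=> Vd UV; apply: (@le_trans _ _ (hausdorff_pre h d
    (\bigcup_i (if i is i'.+1 then
       (if `[< U i' `<=` Q >] then U i' else set0) else V)))).
    apply: (le_hausdorff_pre hg) => // x [/XU[i _ Ux] Qx].
    have [UQ|UQ] := pselect (U i `<=` Q).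
      by exists i.+1 => //=; rewrite asboolT.
    by exists 0%N => //=; exact: UV UQ _ _.
  apply: le_trans (hausdorff_pre_sigma_subadditive hg d _) _.
  rewrite [leLHS]nneseries_recl => [|k _|//]; last exact: (hausdorff_pre_ge0 hg).
  apply: leeD.
    apply: le_trans (hausdorff_pre_single hg d0 Vd) _.
    rewrite lee_fin hmono// ?fine_ge0 ?diam_ge0//.
    by move: (diam_ge0 V) Vd; case: (diam V).
  rewrite -nneseries_addn => [|i]; last exact: (hausdorff_pre_ge0 hg).
  apply: lee_nneseries => [i _ _|i _]; first exact: (hausdorff_pre_ge0 hg).
  rewrite addn1; case: asboolP => _; first exact: (hausdorff_pre_single hg).
  by rewrite (hausdorff_pre_set0 hg).
have dC : diam `[(c - d)%R, c] <= d%:E.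
  apply: diam_le => // x y /=; rewrite !in_itv /= => /andP[? ?] /andP[? ?].
  by rewrite ler_norml; apply/andP; split; lra.
have dP : diam `[c, (c + d)%R] <= d%:E.
  apply: diam_le => // x y /=; rewrite !in_itv /= => /andP[? ?] /andP[? ?].
  by rewrite ler_norml; apply/andP; split; lra.
have s1 := side P _ dP.
have s2 := side (~` P) _ dC.
apply: le_trans (leeD (s1 _) (s2 _)) _.
- move=> i /nonsubset[y [Uy nPy]] x [Ux Px].
  have := le_diam_dist (Ud i) Ux Uy; move: Px nPy.
  rewrite /P /= !in_itv /= !andbT => cx /negP; rewrite -leNgt => yc.
  by rewrite ler_norml => /andP[? ?]; apply/andP; split; lra.
- move=> i /nonsubset[y [Uy nPy]] x [Ux Px].
  have := le_diam_dist (Ud i) Ux Uy; move: Px nPy.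
  rewrite /P /= !in_itv /= !andbT => /negP; rewrite -leNgt => xc /contrapT cy.
  by rewrite ler_norml => /andP[? ?]; apply/andP; split; lra.
rewrite addeACA addeC -EFinD; apply: leeD; last by rewrite lee_fin; lra.
rewrite -nneseriesD => [|i _ _|i _ _]; try by case: ifP; rewrite lee_fin.
apply: lee_nneseries => [i _ _|i _].
  by apply: adde_ge0; case: ifP; rewrite lee_fin.
case: asboolP => UP; case: asboolP => UC; rewrite ?adde0 ?add0e ?lee_fin//.
(* A set counted on both sides lies in a half line and in its complement; it is empty and costs h 0
   = 0. *)
rewrite (_ : U i = set0) ?diam_set0 ?h0 ?adde0//.
by apply/seteqP; split=> // x Ux; exact: (UC x Ux) (UP x Ux).
Qed.

Lemma ge_ereal_sup_add (A B : set \bar R) (c : \bar R) : c \is a fin_num ->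
  A !=set0 -> B !=set0 -> (forall x, A x -> 0 <= x) -> (forall x, B x -> 0 <= x) ->
  (forall x y, A x -> B y -> x + y <= c) -> ereal_sup A + ereal_sup B <= c.
Proof.
move=> fc [a Aa] [b Bb] A0 B0 AB.
have cy : c < +oo by rewrite ltey_eq fc.
have fin x : 0 <= x -> x <= c -> x \is a fin_num.
  by move=> x0 xc; rewrite ge0_fin_numE// (le_lt_trans xc).
have fB y : B y -> y \is a fin_num.
  move=> By; apply: fin; first exact: B0.
  by apply: le_trans (AB _ _ Aa By); rewrite leeDr// A0.
have supA0 : 0 <= ereal_sup A by apply: le_trans (A0 _ Aa) _; exact: ereal_sup_ubound.
have supAB y : B y -> ereal_sup A + y <= c.
  move=> By; rewrite -leeBrDr ?fB//; apply: ge_ereal_sup => x Ax.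
  by rewrite leeBrDr ?fB//; exact: AB.
have fA : ereal_sup A \is a fin_num.
  apply: fin => //; apply: le_trans (supAB _ Bb).
  by rewrite leeDl// B0.
rewrite addeC -leeBrDr//; apply: ge_ereal_sup => y By.
by rewrite leeBrDr// addeC; exact: supAB.
Qed.

(** The splitting inequality at scale d has an error 2 h(d), which right-continuity at 0 makes
    smaller than any e. The two measures on the left are suprema over independent scales, so both
    scales are first reduced to a common smaller one. *)
Lemma hausdorff_ray c : (hausdorff_outer hg).-caratheodory `]c, +oo[.
Proof.
apply: le_caratheodory_measurable => X.
suff : hausdorff h (X `&` `]c, +oo[) + hausdorff h (X `&` ~` `]c, +oo[) <=
    hausdorff h X by [].
have [->|] := eqVneq (hausdorff h X) +oo; first by rewrite leey.
rewrite -ltey => fX.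
have finX : hausdorff h X \is a fin_num by rewrite ge0_fin_numE// (hausdorff_ge0 hg).
apply/lee_addgt0Pr => e e0.
have [h0 hge0 hmono hcont] := hg.
have [d0 d00 hd0] : exists2 d0 : R, (0 < d0)%R & (2 * h d0 <= e)%R.
  have /cvgrPdist_le /(_ (e / 2)%R) := hcont 0%R (lexx _).
  rewrite divr_gt0// => /(_ isT) [r /= r0 hr].
  exists (r / 2)%R; first by rewrite divr_gt0.
  have r2 : (0 < r / 2)%R by rewrite divr_gt0.
  have := hr (r / 2)%R; rewrite h0 sub0r normrN /= sub0r normrN gtr0_norm//.
  rewrite ger0_norm; last by rewrite hge0 ?ltW.
  have -> : (r / 2 < r)%R by lra.
  by move=> /(_ isT r2); lra.
rewrite [hausdorff h (X `&` _)]hausdorffE [hausdorff h (X `&` ~` _)]hausdorffE.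
apply: ge_ereal_sup_add.
- by rewrite fin_numD finX.
- by exists (hausdorff_pre h 1 (X `&` `]c, +oo[)), 1%R => /=.
- by exists (hausdorff_pre h 1 (X `&` ~` `]c, +oo[)), 1%R => /=.
- by move=> _ [d _ <-]; exact: (hausdorff_pre_ge0 hg).
- by move=> _ [d _ <-]; exact: (hausdorff_pre_ge0 hg).
move=> _ _ [d1 /= d10 <-] [d2 /= d20 <-].
pose d := Num.min d0 (Num.min d1 d2).
have dgt0 : (0 < d)%R by rewrite !lt_min d00 d10.
have dd0 : (d <= d0)%R by rewrite ge_min lexx.
have dd1 : (d <= d1)%R by rewrite !ge_min lexx orbT.
have dd2 : (d <= d2)%R by rewrite !ge_min lexx !orbT.
apply: le_trans (leeD (hausdorff_pre_anti _ _ dd1) (hausdorff_pre_anti _ _ dd2)) _.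
apply: le_trans (hausdorff_pre_split c X (ltW dgt0)) _.
apply: leeD; first exact: hausdorff_pre_le.
by rewrite lee_fin (le_trans _ hd0)// ler_wpM2l// hmono// ltW.
Qed.

(** The Caratheodory measurable sets form a sigma-algebra, and the open rays generate the Borel
    sets. *)
Lemma borel_caratheodory (A : set R) :
  measurable A -> (hausdorff_outer hg).-caratheodory A.
Proof.
move=> mA.
have {mA} : (@RGenOInfty.G R).-sigma.-measurable A by rewrite -RGenOInfty.measurableE.
apply: smallest_sub; last by move=> _ [c ->]; exact: hausdorff_ray.
split; first exact: caratheodory_measurable_set0.
  by move=> B mB; rewrite setTD; exact: caratheodory_measurable_setC.
by move=> B mB; exact: caratheodory_measurable_bigcup.
Qed.

Definition hausdorff_measure (hg' : gauge h) : set R -> \bar R := hausdorff h.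

Lemma hausdorff_measure_sigma_additive : semi_sigma_additive (hausdorff_measure hg).
Proof.
move=> A mA tA mUA.
apply: (@caratheodory_measure_sigma_additive _ _ (hausdorff_outer hg)) => //.
  by move=> i; apply: borel_caratheodory; exact: mA.
exact: borel_caratheodory mUA.
Qed.

End HausdorffMeasure.

HB.instance Definition _ (R : realType) (h : R -> R) (hg : gauge h) :=
  isMeasure.Build _ _ _ (hausdorff_measure hg) (hausdorff_set0 hg)
    (hausdorff_ge0 hg) (@hausdorff_measure_sigma_additive R h hg).

(** * Riemann sums over the tiles *)

Section TileMeasure.
Context {R : realType} (S : limit_system R).
Local Notation a := (lend S).
Local Notation b := (rend S).
Local Notation AB := (`[a, b]%classic : set R).
Local Notation F := (fractal S).

(* Two of the images of [a, b] of a given level contain a and b respectively; if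
   they were longer than half of [a, b], they would overlap. *)
Lemma ratio_le_half n i : translation_system S -> (i < nmaps S n)%N ->
  Defs.ratio S n i <= 2^-1.
Proof.
move=> trans i_n; have abS := ends_lt S.
have [j j_n [x abx xa]] := @smap_ends R S n a (or_introl erefl).
have [k k_n [y aby yb]] := @smap_ends R S n b (or_intror erefl).
have ABab z : [set a; b] z -> AB z.
  by case=> ->; rewrite /= in_itv /= lexx ltW.
rewrite (trans n i j i_n j_n); set la := Defs.ratio S n j.
have /andP[la0 la1] : 0 < la < 1 by exact: ratio_itv.
have lak : Defs.ratio S n k = la by exact: trans.
have image (l : nat) : (l < nmaps S n)%N -> exists c d : R, [/\ c < d, d - c = la * (b - a),
    smap S n l @` AB = `[c, d]%classic & a <= c /\ d <= b].
  move=> l_n; have [al al1 aw] := smap_affine l_n.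
  have all : `|al| = la by rewrite al1; exact: trans.
  have al0 : al != 0 by rewrite -normr_gt0 all.
  have [c [d [cd dc e _ _]]] := affine_image_itv al0 aw abS.
  exists c, d; split=> //; first by rewrite dc all.
  have sub := smap_stable l_n; rewrite e in sub.
  have : AB c by apply: sub; rewrite /= in_itv /= lexx ltW.
  have : AB d by apply: sub; rewrite /= in_itv /= lexx ltW.
  by rewrite /= !in_itv /= => /andP[_ ->] /andP[->].
have [c [d [cd dc ej [ac db]]]] := image j j_n.
have [c' [d' [cd' dc' ek [ac' db']]]] := image k k_n.
have ca : c = a.
  apply/eqP; rewrite eq_le ac andbT.
  have : (smap S n j @` AB) a by exists x => //; exact: ABab.
  by rewrite ej /= in_itv /= => /andP[].
have db'' : d' = b.
  apply/eqP; rewrite eq_le db' /=.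
  have : (smap S n k @` AB) b by exists y => //; exact: ABab.
  by rewrite ek /= in_itv /= => /andP[].
(* A single image containing both a and b would have length at least b - a, against [la < 1]. The
   two images are thus disjoint, yet they share the midpoint of [a, b] if la exceeds one half. *)
have jk : j <> k.
  move=> jk; move: ek; rewrite -jk ej => e.
  have : `[c, d]%classic c' by rewrite e /= in_itv /= lexx ltW.
  have : `[c', d']%classic d' by rewrite /= in_itv /= lexx ltW.
  rewrite -e /= !in_itv /= => /andP[_ h1] /andP[h2 _].
  have : 0 < (1 - la) * (b - a) by rewrite mulr_gt0// subr_gt0.
  by lra.
rewrite leNgt; apply/negP => la2.
have h : 0 < (la - 2^-1) * (b - a) by rewrite mulr_gt0// subr_gt0.
have := smap_disjoint j_n k_n jk; rewrite ej ek => /seteqP[sub _].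
by apply: (sub ((a + b) / 2)); split; rewrite /= in_itv /=; apply/andP; split; lra.
Qed.

Lemma tile_dist n I x y : translation_system S -> tiles S n I -> I x -> I y ->
  `|x - y| <= (b - a) / 2 ^+ n.
Proof.
move=> trans tI; have [c [d [cd eI _ _]]] := tile_itv tI.
have [si v dc] := tile_length tI eI cd.
rewrite eI /= !in_itv /= => /andP[? ?] /andP[? ?].
apply: (@le_trans _ _ (d - c)).
  by rewrite ler_norml; apply/andP; split; lra.
rewrite dc mulrC ler_wpM2l ?subr_ge0 ?(ltW (ends_lt S))//.
have -> : (2 ^+ n)^-1 = \prod_(k < n) 2^-1 :> R by rewrite prodr_const card_ord exprVn.
apply: ler_prod => k _; have si_k := v k (ltn_ord k).
by have /andP[/ltW -> _] := ratio_itv si_k; rewrite ratio_le_half.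
Qed.

Lemma hausdorff_tile h n I J : translation_system S -> gauge h ->
  tiles S n I -> tiles S n J ->
  hausdorff h (F `&` I) = hausdorff h (F `&` J).
Proof.
move=> trans hg; wlog suff: I J / tiles S n I -> tiles S n J ->
    (hausdorff h (F `&` J) <= hausdorff h (F `&` I))%E.
  by move=> hw tI tJ; apply/eqP; rewrite eq_le !hw.
move=> tI tJ; have [p [q [pIJ qJI pq qp]]] := tile_map_exists trans tI tJ.
have [[al al1 ap] pI _] := pIJ.
apply: le_trans (hausdorff_isometry h (F `&` I) (p := p) _); last first.
  by move=> x y; rewrite ap normrM al1 mul1r.
apply: le_hausdorff => // x [Fx Jx]; exists (q x); last exact: qp.
by have [] := tile_map_fractal tJ qJI Fx Jx.
Qed.

Lemma tiles_enum n : exists N (t : 'I_N -> set R), [/\ (0 < N)%N,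
  forall i, tiles S n (t i), forall I, tiles S n I -> exists i, t i = I &
  forall i j, t i `&` t j !=set0 -> i = j].
Proof.
have /finite_seqP[s0 es] := finite_tiles S n; pose s := undup s0.
have mem I : tiles S n I <-> I \in s by rewrite es /= mem_undup.
have ts i : tiles S n (tnth (in_tuple s) i) by apply/mem; exact: mem_tnth.
exists (size s), (tnth (in_tuple s)); split=> //.
- have [I /mem] := tiles_nonempty S n; by case: (s).
- move=> I /mem Is; have /tnthP[i ->] : I \in in_tuple s by [].
  by exists i.
- move=> i j /(tiles_disjoint (ts i) (ts j)).
  by have /tuple_uniqP := undup_uniq s0 : uniq (in_tuple s); apply.
Qed.

End TileMeasure.

Section RiemannIntegral.
Context {R : realType} (S : limit_system R).
Hypothesis Stranslation : translation_system S.
Local Notation a := (lend S).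
Local Notation b := (rend S).
Local Notation F := (fractal S).
Variables (h : R -> R) (hg : gauge h).
Hypotheses (hF_gt0 : (0 < hausdorff h F)%E) (hF_lty : (hausdorff h F < +oo)%E).
Local Notation M := (fine (hausdorff h F)).
Variables (g : R -> R) (K : R).
Hypotheses (g_ge0 : forall x, F x -> 0 <= g x)
  (g_lip : forall x y, F x -> F y -> `|g x - g y| <= K * `|x - y|).

Lemma hausdorff_fractal_gt0 : 0 < M.
Proof. by rewrite fine_gt0// hF_gt0. Qed.

Lemma measurable_fractal : measurable F.
Proof. by apply: closed_measurable; exact: (@closed_fractal R S). Qed.

(** Nothing is known of g off F, so continuity is taken for the subspace topology of F. *)
Lemma measurable_lipschitz : measurable_fun F g.
Proof.
apply: subspace_continuous_measurable_fun; first exact: measurable_fractal.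
apply/subspace_continuousP => x Fx; apply/cvgrPdist_le => e e0.
near=> y.
have Fy : F y by near: y; exact: withinT.
apply: le_trans (g_lip Fx Fy) _.
apply: (@le_trans _ _ ((`|K| + 1) * `|x - y|)).
  by rewrite ler_wpM2r// (le_trans (ler_norm K))// lerDl.
rewrite mulrC -ler_pdivlMr ?ltr_wpDl//.
near: y; apply: cvg_within.
have := @nbhsx_ballx _ R x (e / (`|K| + 1)).
rewrite divr_gt0 ?ltr_wpDl// => /(_ isT); apply: filterS => y /=.
by rewrite /ball /= => /ltW.
Unshelve. all: by end_near. Qed.

(** The left end serves as the sample point of a tile, in the integral and in the trace alike; it is
    in F, where the hypotheses on g hold. *)
Lemma tile_end n I : tiles S n I -> F (inf I) /\ I (inf I).
Proof.
move=> /tile_itv[c [d [cd -> Fc Fd]]].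
by rewrite inf_itvcc ?ltW//; split=> //; rewrite /= in_itv /= lexx ltW.
Qed.

Lemma tile_lipschitz n I x : 0 <= K -> tiles S n I -> F x -> I x ->
  `|g x - g (inf I)| <= K * ((b - a) / 2 ^+ n).
Proof.
move=> K0 tI Fx Ix; have [Fc Ic] := tile_end tI.
apply: le_trans (g_lip Fx Fc) _; rewrite ler_wpM2l//.
exact: tile_dist tI Ix Ic.
Qed.

Section Level.
Variables (n N : nat) (t : 'I_N -> set R).
Hypotheses (N_gt0 : (0 < N)%N) (t_tile : forall i, tiles S n (t i))
  (t_surj : forall I, tiles S n I -> exists i, t i = I)
  (t_disj : forall i j, t i `&` t j !=set0 -> i = j).
Hypothesis K_ge0 : 0 <= K.
Local Notation m := (hausdorff_measure hg).
Local Notation A i := (F `&` t i).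
Local Notation e := (K * ((b - a) / 2 ^+ n)).

Lemma measurable_tile i : measurable (A i).
Proof.
apply: measurableI; first exact: measurable_fractal.
have [c [d [_ -> _ _]]] := tile_itv (t_tile i).
exact: measurable_itv.
Qed.

Lemma fractal_tiles : F = \big[setU/set0]_(i < N) A i.
Proof.
rewrite -bigcup_seq; apply/seteqP; split=> [x Fx|x]; last first.
  by move=> [i _ []].
have [I tI Ix] := fractal_tile n Fx; have [i ti] := t_surj tI.
by exists i; [rewrite /= mem_index_enum|split=> //; rewrite ti].
Qed.

Lemma tiles_trivIset (D : set 'I_N) : trivIset D (fun i => A i).
Proof. by apply/trivIsetP => i j _ _; apply: contraNeq => /set0P[x [[_ ix] [_ jx]]];
  apply/eqP/t_disj; exists x. Qed.

Lemma measure_tile i : hausdorff h (A i) = (M / N%:R)%:E.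
Proof.
have eqA j : hausdorff h (A j) = hausdorff h (A i).
  exact: hausdorff_tile Stranslation hg (t_tile j) (t_tile i).
have fin : hausdorff h (A i) \is a fin_num.
  rewrite ge0_fin_numE ?(hausdorff_ge0 hg)//; apply: le_lt_trans hF_lty.
  by apply: (le_hausdorff hg) => x [].
have : hausdorff h F = (\sum_(j < N) hausdorff h (A j))%E.
  (* Finite additivity is read off from the integral of the constant 1 over the disjoint pieces of
     F. *)
  have int1 (B : set R) : measurable B -> hausdorff h B = (\int[m]_(x in B) (cst 1%E x))%E.
    by move=> mB; rewrite (integral_cst m mB 1%E) mul1e.
  rewrite int1; last exact: measurable_fractal.
  rewrite {1}fractal_tiles (@ge0_integral_bigsetU _ _ _ m)//.
  - by apply: eq_bigr => j _; apply/esym/int1; exact: measurable_tile.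
  - exact: measurable_tile.
  - exact: index_enum_uniq.
  - exact: tiles_trivIset.
under eq_bigr do rewrite eqA -(fineK fin).
rewrite sumEFin big_const_ord iter_addr addr0 => /(congr1 fine) /= ->.
by rewrite -(mulr_natr (fine _)) mulfK ?pnatr_eq0 -?lt0n// fineK.
Qed.

Lemma tile_integral i : exists2 v : R,
  (\int[hausdorff h]_(x in A i) (g x)%:E)%E = v%:E &
  `|v - g (inf (t i)) * (M / N%:R)| <= e * (M / N%:R).
Proof.
have mA := measurable_tile i.
have [Fc tc] := tile_end (t_tile i).
have AF x : A i x -> F x by case.
have mg : measurable_fun (A i) (EFin \o g).
  apply/measurable_EFinP; apply: measurable_funS measurable_lipschitz => //.
  exact: measurable_fractal.
have osc x : A i x -> `|g x - g (inf (t i))| <= e.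
  by move=> [Fx tx]; exact: tile_lipschitz (t_tile i) Fx tx.
have e0 : 0 <= e by rewrite mulr_ge0// divr_ge0// subr_ge0 ltW// ends_lt.
have int_cst (r : R) : (\int[m]_(x in A i) r%:E = (r * (M / N%:R))%:E)%E.
  by rewrite (integral_cst m mA r%:E) EFinM -(measure_tile i).
have up : (\int[m]_(x in A i) (g x)%:E <= ((g (inf (t i)) + e) * (M / N%:R))%:E)%E.
  rewrite -int_cst; apply: ge0_le_integral => //.
  - by move=> x /AF Fx; rewrite lee_fin g_ge0.
  - by move=> x Ax; rewrite lee_fin; have := osc x Ax; rewrite ler_norml => /andP[? ?]; lra.
(* The oscillation is added to g instead of being subtracted from the sample value, so that both
   integrands stay nonnegative. *)
have lo : ((g (inf (t i)) * (M / N%:R))%:E <=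
    \int[m]_(x in A i) (g x)%:E + (e * (M / N%:R))%:E)%E.
  rewrite -!int_cst -ge0_integralD//; last first.
    by move=> x /AF Fx; rewrite lee_fin g_ge0.
  apply: ge0_le_integral => //.
  - by move=> x _; rewrite lee_fin g_ge0.
  - by apply: emeasurable_funD.
  - move=> x Ax; rewrite -EFinD lee_fin; have := osc x Ax.
    by rewrite ler_norml => /andP[? ?]; lra.
have i0 : (0 <= \int[m]_(x in A i) (g x)%:E)%E.
  by apply: integral_ge0 => x /AF Fx; rewrite lee_fin g_ge0.
have fi : (\int[m]_(x in A i) (g x)%:E)%E \is a fin_num.
  by rewrite ge0_fin_numE// (le_lt_trans up)// ltry.
exists (fine (\int[m]_(x in A i) (g x)%:E)%E); first by rewrite fineK.
move: up lo; rewrite -(fineK fi) -EFinD !lee_fin => up lo.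
by rewrite ler_norml; apply/andP; split; lra.
Qed.

Lemma integral_riemann :
  (\int[hausdorff h]_(x in F) (g x)%:E)%E \is a fin_num /\
  `|fine (\int[hausdorff h]_(x in F) (g x)%:E)%E / M -
    (\sum_(i < N) g (inf (t i))) / N%:R| <= e.
Proof.
have /choice[v vP] : forall i, exists v : R,
    (\int[hausdorff h]_(x in A i) (g x)%:E)%E = v%:E /\
    `|v - g (inf (t i)) * (M / N%:R)| <= e * (M / N%:R).
  by move=> i; have [v ? ?] := tile_integral i; exists v.
have -> : (\int[hausdorff h]_(x in F) (g x)%:E)%E = (\sum_(i < N) v i)%:E.
  rewrite -sumEFin fractal_tiles.
  rewrite (@ge0_integral_bigsetU _ _ _ m)//.
  - by apply: eq_bigr => i _; have [-> _] := vP i.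
  - exact: measurable_tile.
  - exact: index_enum_uniq.
  - exact: tiles_trivIset.
  - by rewrite -fractal_tiles; apply/measurable_EFinP; exact: measurable_lipschitz.
  - by move=> x; rewrite -fractal_tiles => Fx; rewrite lee_fin g_ge0.
split=> //=.
have M0 := hausdorff_fractal_gt0.
have NM : (N%:R : R) != 0 by rewrite pnatr_eq0 -lt0n.
have -> : (\sum_(i < N) v i) / M - (\sum_(i < N) g (inf (t i))) / N%:R =
    (\sum_(i < N) (v i - g (inf (t i)) * (M / N%:R))) / M.
  rewrite sumrB -mulr_suml; field.
  by rewrite NM gt_eqF.
rewrite normrM [`|M^-1|]gtr0_norm ?invr_gt0// ler_pdivrMr//.
apply: le_trans (ler_norm_sum _ _ _) _.
apply: (@le_trans _ _ (\sum_(i < N) e * (M / N%:R))).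
  by apply: ler_sum => i _; have [] := vP i.
by rewrite big_const_ord iter_addr addr0 -mulrnAr -(mulr_natr (M / _)) divfK.
Qed.

End Level.

End RiemannIntegral.

(** * Comparison of the trace with averages over the tiles *)

Section RiemannTrace.
Context {R : realType} (S : limit_system R).
Hypothesis Stranslation : translation_system S.
Local Notation a := (lend S).
Local Notation b := (rend S).
Local Notation F := (fractal S).
Local Notation I := (boundary_index S).
Local Notation H := (ell2 R I).
Variables (tau : (H -> H) -> \bar R) (tau_singular : singular_trace tau).
Variables (s : R) (s_gt0 : 0 < s).
Local Notation w := (@weight R S s).
Hypothesis tau1 : tau (rdiag w) = 1%E.
Variables (g : R -> R) (K : R).
Hypotheses (K_ge0 : 0 <= K) (g_ge0 : forall x, F x -> 0 <= g x)
  (g_lip : forall x y, F x -> F y -> `|g x - g y| <= K * `|x - y|).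

Lemma weight_bounded : bounded_weight w.
Proof.
exact: (bounded_weight_weight (@interval_length_gt0 R S) (@interval_length_le R S) s_gt0).
Qed.

Lemma weight_pos (i : I) : 0 <= w i.
Proof. by rewrite ltW// weight_gt0//; exact: interval_length_gt0. Qed.

Lemma trace_weight_fin (u : I -> R) : (forall i, 0 <= u i) -> bounded_weight u ->
  tau (rdiag (fun i => u i * w i)) \is a fin_num.
Proof.
move=> u0 [B uB]; rewrite ge0_fin_numE; last first.
  apply: (trace_ge0 tau_singular) => [i|]; first by rewrite mulr_ge0 ?weight_pos.
  by apply: bounded_weightM; [exists B|exact: weight_bounded].
apply: (@le_lt_trans _ _ (tau (rdiag (fun i => `|B| * w i)))).
  apply: (trace_le tau_singular) => [i|]; last first.
    by apply: bounded_weightM; [exact: bounded_weight_cst|exact: weight_bounded].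
  rewrite mulr_ge0 ?weight_pos//= ler_wpM2r ?weight_pos//.
  by rewrite (le_trans (ler_norm _))// (le_trans (uB i))// ler_norm.
rewrite (trace_scale tau_singular) ?normr_ge0// ?tau1 ?mule1 ?ltry//.
- exact: weight_pos.
- exact: weight_bounded.
Qed.

Section Level.
Variables (n N : nat) (t : 'I_N -> set R).
Hypotheses (N_gt0 : (0 < N)%N) (t_tile : forall i, tiles S n (t i))
  (t_surj : forall T, tiles S n T -> exists i, t i = T)
  (t_disj : forall i j, t i `&` t j !=set0 -> i = j).
Local Notation e := (K * ((b - a) / 2 ^+ n)).

Definition inside (k : 'I_N) : set I := [set i | in_tile n (t k) (val i.1)].
Definition outside : set I := [set i | stray S n (val i.1)].

Lemma finite_outside : finite_set outside.
Proof.
have fin : finite_set [set u : set_type (summands S) | stray S n (val u)].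
  apply: (@finite_preimage _ _ (stray S n) val); last exact: finite_stray.
  by move=> u v _ _; exact: val_inj.
have finb : finite_set [set: bool] by exact: finite_finset.
apply: (@sub_finite_set _ _ ([set u | stray S n (val u)] `*` [set: bool])).
  by move=> [u c] h; split.
exact: finite_setX.
Qed.

Lemma inside_unique k l (i : I) : inside k i -> inside l i -> k = l.
Proof.
move=> ik il; apply: t_disj.
have tk := in_tile_boundary_point (t_tile k) ik.
have tl := in_tile_boundary_point (t_tile l) il.
by exists (boundary_point i).
Qed.

Lemma inside_or_outside (i : I) :
  (exists k, inside k i) \/ (outside i /\ forall k, ~ inside k i).
Proof.
have [h|h] := pselect (exists k, inside k i); [by left|right].
split; last by move=> k ik; apply: h; exists k.
split; first exact: (set_mem (valP i.1)).
by move=> T /t_surj[k <-] ik; apply: h; exists k.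
Qed.

Lemma step_inside (c : 'I_N -> R) k i : inside k i ->
  \sum_(l < N) c l * \1_(inside l) i = c k.
Proof.
move=> ik; rewrite (bigD1 k)//= indicE mem_set// mulr1 big1 ?addr0// => l lk.
rewrite indicE memNset ?mulr0// => il.
by move/eqP: lk; apply; exact: inside_unique il ik.
Qed.

Lemma step_outside (c : 'I_N -> R) i : (forall k, ~ inside k i) ->
  \sum_(l < N) c l * \1_(inside l) i = 0.
Proof. by move=> h; rewrite big1// => l _; rewrite indicE memNset ?mulr0. Qed.

Lemma inside_trace_eq k l : tau (rdiag (fun i => \1_(inside k) i * w i)) =
  tau (rdiag (fun i => \1_(inside l) i * w i)).
Proof.
have [->//|kl] := eqVneq k l.
have tkl : t k <> t l.
  move=> tkl; move/eqP: kl; apply; apply: t_disj; rewrite -tkl setIid.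
  by have [c [d [cd -> _ _]]] := tile_itv (t_tile k);
     exists c; rewrite /= in_itv /= lexx ltW.
have [p [pK plen pin]] := swap_index Stranslation (t_tile k) (t_tile l) tkl.
rewrite -(trace_reindex tau_singular (a := fun i => \1_(inside k) i * w i) pK pK).
- congr (tau (rdiag _)); apply/funext => i /=; rewrite /weight plen; congr (_ * _).
  by rewrite !indicE; congr (nat_of_bool _)%:R; apply/idP/idP;
    rewrite !inE => /pin.
- by move=> i; rewrite mulr_ge0 ?weight_pos// indicE.
- by apply: bounded_weightM; [exact: bounded_indic|exact: weight_bounded].
Qed.

Lemma outside_trace (c : R) : 0 <= c ->
  tau (rdiag (fun i => c * \1_outside i * w i)) = 0%E.
Proof.
move=> c0; apply: (trace_finite_support tau_singular finite_outside).
- by move=> i; rewrite !mulr_ge0 ?weight_pos// indicE.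
- apply: bounded_weightM; last exact: weight_bounded.
  by apply: bounded_weightM; [exact: bounded_weight_cst|exact: bounded_indic].
- by move=> i io; rewrite indicE memNset// mulr0 mul0r.
Qed.

Lemma step_trace (c : 'I_N -> R) : (forall k, 0 <= c k) ->
  tau (rdiag (fun i => (\sum_(k < N) c k * \1_(inside k) i) * w i)) =
  (\sum_(k < N) (c k)%:E * tau (rdiag (fun i => \1_(inside k) i * w i)%R))%E.
Proof.
move=> c0.
have bi k : bounded_weight (fun i => \1_(inside k) i * w i).
  by apply: bounded_weightM; [exact: bounded_indic|exact: weight_bounded].
have i0 k i : 0 <= \1_(inside k) i * w i :> R.
  by rewrite mulr_ge0 ?weight_pos// indicE.
rewrite (_ : (fun i => _) =
    (fun i => \sum_(k < N) c k * (\1_(inside k) i * w i))); last first.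
  by apply/funext => i; rewrite mulr_suml; apply: eq_bigr => k _; rewrite mulrA.
rewrite (trace_sum tau_singular).
- by apply: eq_bigr => k _; rewrite (trace_scale tau_singular).
- by move=> k _ i; rewrite mulr_ge0.
- by move=> k _; apply: bounded_weightM => //; exact: bounded_weight_cst.
Qed.

Lemma bounded_step (c : 'I_N -> R) :
  bounded_weight (fun i => \sum_(k < N) c k * \1_(inside k) i).
Proof.
exists (\sum_(k < N) `|c k|) => i; apply: le_trans (ler_norm_sum _ _ _) _.
apply: ler_sum => k _; rewrite normrM ler_piMr// indicE.
by case: (_ \in _); rewrite ?normr1 ?normr0.
Qed.

Lemma inside_trace k : tau (rdiag (fun i => \1_(inside k) i * w i)) = (N%:R^-1)%:E.
Proof.
have fin : tau (rdiag (fun i => \1_(inside k) i * w i)) \is a fin_num.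
  by apply: trace_weight_fin; [move=> i; rewrite indicE|exact: bounded_indic].
(* The factors 1 put both terms in the form of [step_trace] and [outside_trace]; the N equal inner
   traces then add up to 1. *)
have : tau (rdiag w) = (tau (rdiag (fun i => (\sum_(l < N) 1 * \1_(inside l) i) * w i)%R) +
    tau (rdiag (fun i => 1 * \1_outside i * w i)%R))%E.
  rewrite -(trace_add tau_singular).
  - congr (tau (rdiag _)); apply/funext => i; rewrite -mulrDl mul1r.
    have [[l il]|[io ni]] := inside_or_outside i.
      rewrite (step_inside (fun=> 1) il) indicE memNset ?addr0 ?mul1r//.
      by move=> [_ /(_ _ (t_tile l))]; apply.
    by rewrite (step_outside (fun=> 1) ni) indicE mem_set// add0r mul1r.
  - by move=> i; rewrite mulr_ge0 ?weight_pos// sumr_ge0// => l _; rewrite mul1r indicE.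
  - by move=> i; rewrite !mulr_ge0 ?weight_pos// indicE.
  - by apply: bounded_weightM; [exact: bounded_step|exact: weight_bounded].
  - apply: bounded_weightM; last exact: weight_bounded.
    by apply: bounded_weightM; [exact: bounded_weight_cst|exact: bounded_indic].
rewrite [X in (_ + X)%E]outside_trace// adde0 [RHS]step_trace// [LHS]tau1.
under eq_bigr do rewrite (inside_trace_eq _ k) -(fineK fin) mul1e.
rewrite sumEFin big_const_ord iter_addr addr0 => -[h].
rewrite -(fineK fin); congr EFin; apply: (mulIf (_ : N%:R != 0 :> R)).
  by rewrite pnatr_eq0 -lt0n.
by rewrite mulr_natr -h mulVf// pnatr_eq0 -lt0n.
Qed.

Lemma trace_riemann :
  `|fine (tau (rdiag (fun i => g (boundary_point i) * w i))) -
    (\sum_(k < N) g (inf (t k))) / N%:R| <= e.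
Proof.
have e0 : 0 <= e by rewrite mulr_ge0// divr_ge0// subr_ge0 ltW// ends_lt.
have Fbp (i : I) : F (boundary_point i) by exact: boundary_point_fractal.
have Fc k : F (inf (t k)) by have [] := tile_end (t_tile k).
pose c k := g (inf (t k)).
have c0 k : 0 <= c k by exact: g_ge0.
have [Fa _] := ends_fractal S.
(* A bound for g on F, from the Lipschitz condition at a; it dominates g at the finitely many outer
   indices, which contribute nothing to the trace. *)
pose B := g a + K * (b - a).
have gB x : F x -> g x <= B.
  move=> Fx; have := g_lip Fx Fa; rewrite ler_norml => /andP[_ h].
  have : K * `|x - a| <= K * (b - a).
    rewrite ler_wpM2l//; have := fractal_sub Fx; rewrite /= in_itv /= => /andP[? ?].
    by rewrite ger0_norm ?subr_ge0// lerB.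
  by rewrite /B; lra.
have B0 : 0 <= B by apply: le_trans (g_ge0 Fa) (gB _ Fa).
have bg : bounded_weight (fun i : I => g (boundary_point i)).
  by exists B => i; rewrite ger0_norm ?gB// g_ge0.
have g0 (i : I) : 0 <= g (boundary_point i) by exact: g_ge0.
have osc k (i : I) : inside k i -> `|g (boundary_point i) - c k| <= e.
  move=> ik; apply: (tile_lipschitz Stranslation g_lip K_ge0 (t_tile k)) => //.
  exact: in_tile_boundary_point (t_tile k) ik.
have fg := trace_weight_fin g0 bg.
have stepE (d : 'I_N -> R) : (forall k, 0 <= d k) ->
    tau (rdiag (fun i => (\sum_(k < N) d k * \1_(inside k) i) * w i)) =
    ((\sum_(k < N) d k) / N%:R)%:E.
  move=> d0; rewrite step_trace//.
  by under eq_bigr do rewrite inside_trace -EFinM; rewrite sumEFin mulr_suml.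
have up : (tau (rdiag (fun i => g (boundary_point i) * w i)%R) <=
    ((\sum_(k < N) (c k + e)) / N%:R)%:E)%E.
  have ce0 k : 0 <= c k + e by rewrite addr_ge0.
  rewrite -stepE//.
  apply: (@le_trans _ _ (tau (rdiag (fun i =>
    (\sum_(k < N) (c k + e) * \1_(inside k) i) * w i + B * \1_outside i * w i)))).
    apply: (trace_le tau_singular) => [i|]; last first.
      apply: bounded_weightD; apply: bounded_weightM; try exact: weight_bounded.
        exact: bounded_step.
      by apply: bounded_weightM; [exact: bounded_weight_cst|exact: bounded_indic].
    rewrite mulr_ge0 ?weight_pos//= -mulrDl ler_wpM2r ?weight_pos//.
    have [[l il]|[io ni]] := inside_or_outside i.
      rewrite (step_inside (fun k => c k + e) il).
      have := osc _ _ il; rewrite ler_norml => /andP[_ h].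
      have : 0 <= B * \1_outside i by rewrite mulr_ge0// indicE.
      by move: h; move: (e) => e'; lra.
    by rewrite (step_outside (fun k => c k + e) ni) indicE mem_set// add0r mulr1 gB.
  rewrite (trace_add tau_singular).
  - by rewrite [X in (_ + X)%E]outside_trace// adde0.
  - by move=> i; rewrite mulr_ge0 ?weight_pos// sumr_ge0// => k _; rewrite mulr_ge0// indicE.
  - by move=> i; rewrite !mulr_ge0 ?weight_pos// indicE.
  - by apply: bounded_weightM; [exact: bounded_step|exact: weight_bounded].
  - apply: bounded_weightM; last exact: weight_bounded.
    by apply: bounded_weightM; [exact: bounded_weight_cst|exact: bounded_indic].
(* The error is again added to g, because c k - e may be negative; the added operator e w has trace
   e by normalization. *)
have lo : (((\sum_(k < N) c k) / N%:R)%:E <=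
    tau (rdiag (fun i => g (boundary_point i) * w i)%R) + e%:E)%E.
  rewrite -stepE// -[e%:E]mule1 -tau1 -(trace_scale tau_singular e0 weight_pos weight_bounded).
  rewrite -(trace_add tau_singular); last 4 first.
  - by move=> i; rewrite mulr_ge0 ?weight_pos.
  - by move=> i; rewrite mulr_ge0 ?weight_pos.
  - by apply: bounded_weightM => //; exact: weight_bounded.
  - by apply: bounded_weightM; [exact: bounded_weight_cst|exact: weight_bounded].
  apply: (trace_le tau_singular) => [i|]; last first.
    apply: bounded_weightD; apply: bounded_weightM => //; try exact: weight_bounded.
    exact: bounded_weight_cst.
  rewrite mulr_ge0 ?weight_pos ?sumr_ge0//=; last by move=> k _; rewrite mulr_ge0// indicE.
  rewrite -mulrDl ler_wpM2r ?weight_pos//.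
  have [[l il]|[io ni]] := inside_or_outside i; last first.
    by rewrite (step_outside c ni) addr_ge0.
  rewrite (step_inside c il); have := osc _ _ il; rewrite ler_norml => /andP[h _].
  by move: h; move: (e) => e'; lra.
have NM : (N%:R : R) != 0 by rewrite pnatr_eq0 -lt0n.
have ee : (\sum_(k < N) (c k + e)) / N%:R = (\sum_(k < N) c k) / N%:R + e.
  by rewrite big_split /= mulrDl big_const_ord iter_addr addr0 -[e *+ N]mulr_natr mulfK.
move: up lo; rewrite ee -(fineK fg) -EFinD !lee_fin /c => up lo.
rewrite ler_norml; apply/andP; split.
  by rewrite lerBrDr addrC lerBlDr.
by rewrite lerBlDl.
Qed.

End Level.

End RiemannTrace.

Lemma eq_of_dist_le_pow2 (R : realType) (x y C : R) :
  (forall n, `|x - y| <= C / 2 ^+ n) -> x = y.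
Proof.
move=> xy; apply/eqP; rewrite -subr_eq0 -normr_le0 leNgt; apply/negP => d0.
have C0 : 0 <= C / `|x - y|.
  by rewrite divr_ge0//; have := xy 0%N; rewrite expr0 divr1; exact: le_trans.
have := archi_boundP C0; set n := Num.bound _ => hn.
have := xy n; rewrite ler_pdivlMr ?exprn_gt0// leNgt => /negP; apply.
rewrite mulrC -ltr_pdivrMr//; apply: lt_le_trans hn _.
by rewrite -natrX ler_nat ltnW// ltn_expl.
Qed.

(** * The trace equals the normalized integral *)

Section TraceIntegral.
Context {R : realType} (S : limit_system R).
Hypothesis Stranslation : translation_system S.
Local Notation F := (fractal S).
Local Notation H := (ell2 R (boundary_index S)).
Variables (h : R -> R) (hg : gauge h).
Hypotheses (hF_gt0 : (0 < hausdorff h F)%E) (hF_lty : (hausdorff h F < +oo)%E).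
Local Notation M := (fine (hausdorff h F)).
Variables (tau : (H -> H) -> \bar R) (tau_singular : singular_trace tau).
Variables (s : R) (s_gt0 : 0 < s).
Local Notation w := (@weight R S s).
Hypothesis tau1 : tau (rdiag w) = 1%E.

(** Both sides are compared with the same average of g over the left ends of the tiles; the factor 2
    in the bound counts the two errors. *)
Lemma trace_integral (g : R -> R) (K : R) : 0 <= K -> (forall x, F x -> 0 <= g x) ->
  (forall x y, F x -> F y -> `|g x - g y| <= K * `|x - y|) ->
  (\int[hausdorff h]_(x in F) (g x)%:E)%E \is a fin_num /\
  fine (tau (rdiag (fun i => g (boundary_point i) * w i))) =
    fine (\int[hausdorff h]_(x in F) (g x)%:E)%E / M.
Proof.
move=> K0 g0 gl.
have level n : (\int[hausdorff h]_(x in F) (g x)%:E)%E \is a fin_num /\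
    `|fine (tau (rdiag (fun i => g (boundary_point i) * w i))) -
      fine (\int[hausdorff h]_(x in F) (g x)%:E)%E / M| <=
    2 * (K * (rend S - lend S)) / 2 ^+ n.
  have [N [t [N0 tt ts td]]] := tiles_enum S n.
  have [fi ri] := integral_riemann Stranslation hg hF_gt0 hF_lty g0 gl N0 tt ts td K0.
  have rt := trace_riemann Stranslation tau_singular s_gt0 tau1 K0 g0 gl N0 tt ts td.
  split=> //; rewrite distrC in ri; apply: le_trans (ler_distD _ _ _) _.
  by apply: le_trans (lerD rt ri) _; rewrite le_eqVlt; apply/orP; left; apply/eqP; ring.
split; first by have [] := level 0%N.
by apply: eq_of_dist_le_pow2 => n; have [_] := level n; exact.
Qed.

Lemma integral_max (v : R -> R) :
  (\int[hausdorff h]_(x in F) (Num.max (v x) 0)%:E)%E \is a fin_num ->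
  (\int[hausdorff h]_(x in F) (Num.max (- v x) 0)%:E)%E \is a fin_num ->
  fine (\int[hausdorff h]_(x in F) (v x)%:E)%E =
  fine (\int[hausdorff h]_(x in F) (Num.max (v x) 0)%:E)%E -
  fine (\int[hausdorff h]_(x in F) (Num.max (- v x) 0)%:E)%E.
Proof.
move=> fp fn; rewrite -fineB//; congr fine.
rewrite (@integralE _ _ _ (hausdorff_measure hg)).
by congr (_ - _)%E; apply: (@eq_integral _ _ _ (hausdorff_measure hg)) => x _;
  rewrite ?funeposE ?funenegE -?EFinN -EFin_max.
Qed.

(** Taking the maximum with 0 is 1-Lipschitz, so the positive and negative parts of v keep the
    constant K. *)
Lemma trace_integral_parts (v : R -> R) (K : R) : 0 <= K ->
  (forall x y, F x -> F y -> `|v x - v y| <= K * `|x - y|) ->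
  fine (tau (rdiag (fun i => Num.max (v (boundary_point i)) 0 * w i))) -
  fine (tau (rdiag (fun i => Num.max (- v (boundary_point i)) 0 * w i))) =
    M^-1 * fine (\int[hausdorff h]_(x in F) (v x)%:E)%E.
Proof.
move=> K0 vl.
have max_lip (x y : R) : `|Num.max x 0 - Num.max y 0| <= `|x - y|.
  wlog xy : x y / x <= y.
    move=> hw; case: (leP x y) => [/hw//|/ltW yx].
    by rewrite distrC [leRHS]distrC; exact: hw.
  rewrite distrC [leRHS]distrC [leRHS]ger0_norm ?subr_ge0//.
  have mm : Num.max x 0 <= Num.max y 0 by rewrite ge_max !le_max xy lexx orbT.
  rewrite ger0_norm ?subr_ge0//.
  by case: (lerP y 0) => y0; case: (lerP x 0) => x0; lra.
have max0 (x : R) : 0 <= Num.max x 0 by rewrite le_max lexx orbT.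
have [fp ->] := @trace_integral (fun x => Num.max (v x) 0) K K0 (fun x _ => max0 (v x))
  (fun x y Fx Fy => le_trans (max_lip _ _) (vl x y Fx Fy)).
have nvl x y : F x -> F y -> `|- v x - - v y| <= K * `|x - y|.
  by move=> Fx Fy; rewrite -opprD normrN; exact: vl.
have [fn ->] := @trace_integral (fun x => Num.max (- v x) 0) K K0
  (fun x _ => max0 (- v x)) (fun x y Fx Fy => le_trans (max_lip _ _) (nvl x y Fx Fy)).
by rewrite (integral_max fp fn) mulrBr ![_ / M]mulrC.
Qed.

End TraceIntegral.

Theorem corollary4p9 (R : realType) (S : limit_system R)
  (Stranslation : translation_system S)
  (h : R -> R) (hgauge : gauge h)
  (hF_gt0 : (0 < hausdorff h (fractal S))%E)
  (hF_lty : (hausdorff h (fractal S) < +oo)%E)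
  (s : R) (s_exponent : traceability_exponent S s)
  (tau : (ell2 R (boundary_index S) -> ell2 R (boundary_index S)) -> \bar R)
  (tau_singular : singular_trace tau)
  (tau1 : tau (abs_power (dirac_operator S) (- s)) = 1%E)
  (f : R -> R[i]) (fLip : lip_algebra S f) :
  trace_domain tau (besicovitch_operator S s f) /\
  trace_ext tau (besicovitch_operator S s f) =
    ((fine (hausdorff h (fractal S)))^-1)%:C *
    cintegral (hausdorff h) (fractal S) f.
Proof.
have [s0 _] := s_exponent.
have wE := abs_powerE (@interval_length_gt0 R S) (@interval_length_le R S) s0.
rewrite wE in tau1.
(* The sign of the Lipschitz constant is not part of [lip_algebra]; its absolute value serves as
   well. *)
have [K0 fK0] := fLip; pose K : R := `|K0|.
have K_ge0 : 0 <= K by exact: normr_ge0.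
have fK x y : fractal S x -> fractal S y -> normc (f x - f y) <= K * `|x - y|.
  by move=> Fx Fy; apply: le_trans (fK0 x y Fx Fy) _; rewrite ler_wpM2r// ler_norm.
have normc_ge0 (z : R[i]) : 0 <= normc z by case: z => x y /=; rewrite sqrtr_ge0.
have Re_le (z : R[i]) : `|Re z| <= normc z.
  by case: z => x y /=; rewrite -sqrtr_sqr ler_wsqrtr// lerDl sqr_ge0.
have Im_le (z : R[i]) : `|Im z| <= normc z.
  by case: z => x y /=; rewrite -sqrtr_sqr ler_wsqrtr// lerDr sqr_ge0.
have ReB (x y : R[i]) : Re (x - y) = Re x - Re y by case: x y => ? ? [].
have ImB (x y : R[i]) : Im (x - y) = Im x - Im y by case: x y => ? ? [].
have [Fa _] := ends_fractal S.
(* The values of f at the boundary points are bounded because these points lie in F; this makes the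
   multiplication operator bounded. *)
have fM (i : boundary_index S) :
    normc (f (boundary_point i)) <= normc (f (lend S)) + K * (rend S - lend S).
  have Fi := boundary_point_fractal i.
  rewrite -[f (boundary_point i)](subrK (f (lend S))) addrC.
  apply: le_trans (le_normcD _ _) _; rewrite lerD2l (le_trans (fK _ _ Fi Fa))//.
  apply: ler_wpM2l => //; have := fractal_sub Fi; rewrite /= in_itv /= => /andP[? ?].
  by rewrite ger0_norm ?subr_ge0// lerB.
have tau_fin : (tau (rdiag (@weight R S s)) < +oo)%E by rewrite tau1 ltry.
have := trace_value_multiplication tau_singular fM (weight_pos s)
  (weight_bounded S s0) tau_fin.
have ReK x y : fractal S x -> fractal S y -> `|Re (f x) - Re (f y)| <= K * `|x - y|.
  by move=> Fx Fy; rewrite -ReB (le_trans (Re_le _))// fK.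
have ImK x y : fractal S x -> fractal S y -> `|Im (f x) - Im (f y)| <= K * `|x - y|.
  by move=> Fx Fy; rewrite -ImB (le_trans (Im_le _))// fK.
have parts := trace_integral_parts Stranslation hgauge hF_gt0 hF_lty tau_singular s0 tau1.
have eRe := parts (fun x => Re (f x)) K K_ge0 ReK.
have eIm := parts (fun x => Im (f x)) K K_ge0 ImK.
rewrite /= eRe eIm => val.
have TE : besicovitch_operator S s f =
    multiplication (fun i => f (boundary_point i)) \o rdiag (@weight R S s).
  by rewrite /besicovitch_operator wE.
rewrite TE; split; first by eexists; exact: val.
rewrite (trace_ext_value tau_singular val) /cintegral.
by apply/eqP; rewrite eq_complex /= !mul0r subr0 addr0 !eqxx.
Qed.
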